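(* Let $p,q\in\mathbb{N}_0$. There exist $n_0\in\mathbb{N}$, $\varepsilon>0$ and $C>0$, depending only on $p$ and $q$, such that the following holds. Let $n\ge n_0$ and let $x_1<x_2<\ldots<x_n$ be real numbers with $\sum_{k=1}^n x_k=0$, $\sum_{k=1}^n x_k^2=1$ and $\sum_{k=1}^n|x_k|^3\le\varepsilon$. Then for every $t\in\mathbb{R}$, \[ \left|t^p\,\partial_t^q\left(\frac{1}{\sqrt{2\pi}}e^{-t^2/2}-\sum_{k=1}^n\frac{\left(x_k-\frac{t}{n}\right)_+^{n-2}}{\prod_{j\ne k}(x_k-x_j)}\right)\right|\le C\sum_{k=1}^n|x_k|^3 . \]
   Context: $\mathbb{N}_0=\{0,1,2,\ldots\}$. For real $y$ and an integer $d\ge 1$, $(y)_+^{d}=\max(y,0)^{d}$. The product $\prod_{j\neq k}$ runs over $j\in\{1,\ldots,n\}\setminus\{k\}$. $\partial_t^q$ is the $q$-th derivative with respect to $t$. *)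

(* Defs.v *)
From mathcomp Require Import all_boot all_order all_algebra.
From mathcomp Require Import all_classical all_reals all_analysis.
Import Order.TTheory GRing.Theory Num.Theory.
Import numFieldNormedType.Exports.

Set Implicit Arguments.
Unset Strict Implicit.
Unset Printing Implicit Defensive.

Local Open Scope classical_set_scope.
Local Open Scope ring_scope.

Definition pospow (R : realType) (y : R) (d : nat) : R := Num.max y 0 ^+ d.

Definition gauss_density (R : realType) (t : R) : R :=
  1 / Num.sqrt (2 * pi) * expR (- t ^+ 2 / 2).

(* The exponent is natural-number subtraction, so it is meaningful only for
   n >= 2; for n = 2 it is 0, and then pospow is the constant 1. *)
Definition spline_sum (R : realType) (n : nat) (x : 'I_n -> R) (t : R) : R :=
  \sum_(k < n) pospow (x k - t / n%:R) (n - 2)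
               / \prod_(j < n | j != k) (x k - x j).

(* derive1n is total; this says that derive1n q f t is a genuine q-th derivative,
   provided it holds for all t in a neighbourhood. *)
Definition derivable_up_to (R : realType) (q : nat) (f : R -> R) (t : R) : Prop :=
  forall i : nat, (i < q)%N -> derivable (derive1n i f) t 1.

(* Main.v *)
(** The normalized B-spline [sum_k (x_k - t/n)_+^(n-2) / prod_(j != k) (x_k - x_j)]
    has, with [a_k = x_k - t/n], the Fourier representation
    [1/(2 pi) int prod_k (1 - i xi a_k)^-1 dxi], by partial fractions; its
    derivatives carry extra factors [i xi].  Write [kint q s] for the integral of
    [(i xi)^q prod_(a in s) (1 - i xi a)^-1] over the real line, [s] a list of
    knots in which repetitions are allowed.  Expanding one factor and
    integrating by parts in [xi] give
      [- (sum_s a) kint q s = q kint (q-1) s + sum_(a in s) a^2 kint (q+1) (a :: s)].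
    The modulus of the product is at most [(1 + sigma^2 xi^2 / M)^(-M/2)], where
    [sigma^2 = sum a_k^2 = 1 + t^2/n], so every [kint q s] is bounded, and iterating
    the identity gives polynomial decay in [t].  Applied to the knots [a_k], whose
    sum is [-t], it says that the spline solves the Gaussian equation
    [f' + t f = 0], and its derivatives the differentiated equations, up to
    errors of size [sum |x_k|^3].  The error [phi - f] therefore solves an
    inhomogeneous Gaussian equation with a small right-hand side; the remaining
    multiple of the Gaussian is fixed by comparing the masses [1] and
    [n/(n-1)], and the derivatives follow from the recurrences. *)
Require Import Defs.
From mathcomp Require Import all_boot all_order all_algebra.
From mathcomp Require Import all_classical all_reals all_analysis.
From mathcomp Require Import measurable_realfun complex zify ring lra.
Import Order.TTheory GRing.Theory Num.Theory.
Import numFieldNormedType.Exports.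

Set Implicit Arguments.
Unset Strict Implicit.
Unset Printing Implicit Defensive.

Local Open Scope classical_set_scope.
Local Open Scope ring_scope.

(** * Integrals over the whole real line *)

Section RealLineIntegral.
Context {R : realType}.
Notation mu := (@lebesgue_measure R).
Implicit Types f F : R -> R.

Definition integrableR f := mu.-integrable [set: R] (EFin \o f).
Definition integralR f : R := \int[mu]_x f x.

Lemma integrableRP f K c : 0 < c -> continuous f ->
  (forall x, `|f x| <= K / (1 + (c * x) ^+ 2)) -> integrableR f.
Proof.
move=> c0 cf fK.
have K0 : 0 <= K.
  have := le_trans (normr_ge0 _) (fK 0).
  by rewrite mulr0 expr0n addr0 invr1 mulr1.
(* With this [C], [K / (1 + (c x)^2) <= C / (1 + x^2)] whatever the scale [c > 0], so the known
   integral of [1 / (1 + x^2)] serves as majorant. *)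
pose C := K * (1 + c ^- 2).
have C0 : 0 <= C by rewrite mulr_ge0// addr_ge0// invr_ge0 exprn_ge0// ltW.
have fC x : `|f x| <= C * (oneDsqr x)^-1.
  apply: (le_trans (fK x)); rewrite /C -mulrA ler_wpM2l//.
  rewrite /oneDsqr -[leLHS]mul1r.
  have c2 : 0 < c ^+ 2 by rewrite exprn_gt0.
  have x2 := sqr_ge0 x; have cx2 := sqr_ge0 (c * x).
  rewrite ler_pdivlMr; last by lra.
  rewrite mulrAC ler_pdivrMr; last by lra.
  have dc : c ^- 2 * c ^+ 2 = 1 by rewrite mulVf// lt0r_neq0.
  have d0 : 0 <= c ^- 2 by rewrite invr_ge0 ltW.
  have -> : (1 + c ^- 2) * (1 + (c * x) ^+ 2) =
    1 + (c ^- 2 * c ^+ 2) * x ^+ 2 + (c * x) ^+ 2 + c ^- 2 by ring.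
  by rewrite dc; lra.
have mf : measurable_fun setT f by exact: continuous_measurable_fun.
apply/integrableP; split; first exact/measurable_EFinP.
have mV : measurable_fun setT (fun x : R => (oneDsqr x)^-1).
  by apply: continuous_measurable_fun; exact: continuous_oneDsqrV.
have m1 : measurable_fun setT (fun x : R => (C * (oneDsqr x)^-1)%:E).
  by apply/measurable_EFinP; apply: measurable_funM.
have O0 (x : R) : 0 <= (oneDsqr x)^-1 by rewrite invr_ge0.
have D0 (x : R) : 0 <= C * (oneDsqr x)^-1 by rewrite mulr_ge0.
apply: (@le_lt_trans _ _ (\int[mu]_x (C * (oneDsqr x)^-1)%:E)%E).
  apply: ge0_le_integral => //=.
  - by do 2 apply: measurableT_comp => //; exact/measurable_EFinP.
  - by move=> x _; rewrite lee_fin.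
rewrite (@ge0_symfun_integralT R (fun x => C * (oneDsqr x)^-1)) //; last 2 first.
- by move=> x; apply: cvgM; [exact: cvg_cst|exact: continuous_oneDsqrV].
- by move=> x; rewrite /oneDsqr /= sqrrN.
have -> : [set x : R | 0 <= x] = `[0, +oo[%classic.
  by apply/seteqP; split => x /=; rewrite in_itv/= andbT.
under eq_integral do rewrite EFinM.
rewrite ge0_integralZl//; last first.
  exact/measurable_EFinP/measurable_funTS.
by rewrite integral0y_oneDsqr -!EFinM ltry.
Qed.

(** Dominated convergence along the intervals [[-n, n]], with [|f|] as majorant, reduces the
    integral to the symmetric differences of [F]. *)
Lemma integralR_FTC F f (l : R) : integrableR f -> continuous f ->
  (forall x : R, is_derive x 1 F (f x)) ->
  (fun n : nat => F n%:R - F (- n%:R)) @ \oo --> l -> integralR f = l.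
Proof.
move=> fi cf dF Fl.
pose A (n : nat) : set R := `[- n%:R, n%:R]%classic.
pose f_ (n : nat) x : \bar R := ((f \_ (A n)) x)%:E.
have mf : measurable_fun setT f by exact: continuous_measurable_fun.
have mA n : measurable (A n) by exact: measurable_itv.
have Hf_ n : (\int[mu]_x f_ n x = (F n%:R - F (- n%:R))%:E)%E.
  transitivity (\int[mu]_(x in A n) (f x)%:E)%E.
    by rewrite [RHS]integral_mkcond restrict_EFin.
  have [->|n0] := eqVneq n 0%N.
    by rewrite /A oppr0 set_itv1 integral_set1 subrr.
  have n0' : 0 < n%:R :> R by rewrite ltr0n lt0n.
  rewrite (@continuous_FTC2 R f F) ?EFinB//.
  - by lra.
  - by apply: continuous_in_subspaceT => x _; exact: cf.
  - split.
    + by move=> x _; exact: (@ex_derive _ _ _ _ _ _ _ (dF x)).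
    + by apply: cvg_at_right_filter; apply: differentiable_continuous;
        apply/derivable1_diffP; exact: (@ex_derive _ _ _ _ _ _ _ (dF _)).
    + by apply: cvg_at_left_filter; apply: differentiable_continuous;
        apply/derivable1_diffP; exact: (@ex_derive _ _ _ _ _ _ _ (dF _)).
  - by move=> x _; rewrite derive1E; exact: (@derive_val _ _ _ _ _ _ _ (dF x)).
have := @dominated_convergence _ _ _ mu setT measurableT f_ (EFin \o f)
  (fun x => `|f x|%:E).
case.
- move=> n; apply/measurable_EFinP; apply: (measurable_restrictT f (mA n)).1.
  exact: measurable_funTS.
- exact/measurable_EFinP.
- apply: aeW => x _; apply: cvg_near_cst; near=> n.
  rewrite /f_ patchE ifT// /A inE /= in_itv /= -ler_norml.
  by near: n; apply: nbhs_infty_ger.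
- by have := integrable_abse fi.
- apply: aeW => x n _; rewrite /f_ lee_fin patchE; case: ifP => // _.
  by rewrite normr0.
move=> _ _ /=.
under eq_fun do rewrite Hf_.
move=> Hc.
have Hl : ((fun n : nat => (F n%:R - F (- n%:R))%:E) @ \oo --> l%:E)%E.
  exact/cvg_EFin/Fl/nearW.
rewrite /integralR /Rintegral.
by rewrite -(cvg_lim _ Hc)// (cvg_lim _ Hl).
Unshelve. all: by end_near. Qed.

(** Writing the limit with [Num.sg] treats both signs and [a = 0] at once; these signs later become
    the positive parts of the knots. *)
Lemma cvg_atan_diff (a : R) :
  (fun n : nat => atan (a * n%:R) - atan (a * - n%:R)) @ \oo --> Num.sg a * pi.
Proof.
have pos (b : R) : 0 < b -> (fun n : nat => atan (b * n%:R)) @ \oo --> pi / 2.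
  move=> b0; apply: (@cvg_comp _ _ _ (fun n : nat => b * n%:R) (@atan R)).
    apply: (@cvg_comp _ _ _ (fun n : nat => n%:R : R) (fun r => b * r)).
      exact: cvgr_idn.
    by apply: gt0_cvgMry => //; exact: cvg_id.
  exact: cvgy_atan.
under eq_fun do rewrite mulrN atanN opprK.
have -> : Num.sg a * pi = Num.sg a * (pi / 2) + Num.sg a * (pi / 2).
  by rewrite -mulrDr -splitr.
suff cva : (fun n : nat => atan (a * n%:R)) @ \oo --> Num.sg a * (pi / 2).
  exact: (cvgD cva cva).
have [a0|a0|->] := ltrgt0P a.
- by rewrite gtr0_sg// mul1r; exact: pos.
- rewrite ltr0_sg// mulN1r.
  have -> : (fun n : nat => atan (a * n%:R)) = (fun n : nat => - atan (- a * n%:R)).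
    by apply/funext => n; rewrite mulNr atanN opprK.
  by apply: cvgN; apply: pos; rewrite oppr_gt0.
- under eq_fun do rewrite mul0r atan0.
  by rewrite sgr0 mul0r; exact: cvg_cst.
Qed.

(** The majorant has the antiderivative [K / c * atan (c * x)], which gives its integral exactly. *)
Lemma le_integralR f K c : 0 < c -> continuous f ->
  (forall x, `|f x| <= K / (1 + (c * x) ^+ 2)) ->
  `|integralR f| <= K * (pi / c).
Proof.
move=> c0 cf fK.
pose g x : R := K / (1 + (c * x) ^+ 2).
have K0 : 0 <= K.
  have := le_trans (normr_ge0 _) (fK 0).
  by rewrite mulr0 expr0n addr0 invr1 mulr1.
have pos x : 0 < 1 + (c * x) ^+ 2 by have := sqr_ge0 (c * x); lra.
have cg : continuous g.
  move=> x; apply: cvgM; first exact: cvg_cst.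
  apply: cvgV; first by rewrite lt0r_neq0.
  apply: cvgD; first exact: cvg_cst.
  apply: (@cvg_comp _ _ _ (fun x => c * x) (fun x => x ^+ 2)).
    by apply: cvgM; [exact: cvg_cst|exact: cvg_id].
  exact: sqr_continuous.
have gi : integrableR g.
  apply: (integrableRP c0 cg (K := K)) => x.
  by rewrite ger0_norm // /g divr_ge0 // ltW.
have fi : integrableR f by exact: (integrableRP c0 cf fK).
apply: (le_trans (le_normr_Rintegral _ fi)) => //.
have <- : integralR g = K * (pi / c).
  apply: (@integralR_FTC (fun x => K / c * atan (c * x))) => //.
  - move=> x; apply: is_derive_eq.
    rewrite /g /GRing.scale/=.
    rewrite !(mulr0, mul0r, add0r, addr0, mulr1).
    by rewrite [_^-1 * c]mulrC mulrA mulfVK ?lt0r_neq0.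
  - have -> : K * (pi / c) = K / c * (Num.sg c * pi).
      by rewrite gtr0_sg// mul1r mulrA mulrAC.
    under eq_fun do rewrite -mulrBr.
    by apply: cvgM; [exact: cvg_cst|exact: cvg_atan_diff].
apply: le_Rintegral => //.
exact: integrable_norm.
Qed.

End RealLineIntegral.

(** * Lagrange interpolation and partial fractions *)

Section Lagrange.
Context {F : fieldType} {n : nat}.
Variable a : 'I_n -> F.
Hypothesis inj_a : injective a.

Let den k := \prod_(j < n | j != k) (a k - a j).

Let den_neq0 k : den k != 0.
Proof.
apply/prodf_neq0 => j jk; rewrite subr_eq0.
by apply: contra jk => /eqP/inj_a ->.
Qed.

Let size_others (k : 'I_n) : size [seq j <- index_enum 'I_n | j != k] = n.-1.
Proof. by rewrite size_filter -sum1_count sum1_card cardC1 card_ord. Qed.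

(** The difference of the two sides has size at most [n] and vanishes at the [n] distinct points
    [a i], hence is zero. *)
Lemma lagrange_monomial m : (m < n)%N ->
  'X^m = \sum_(k < n) (a k ^+ m / den k) *: \prod_(j < n | j != k) ('X - (a j)%:P).
Proof.
move=> mn; apply/eqP; rewrite -subr_eq0; apply/eqP.
set p := (X in X = _).
apply: (@roots_geq_poly_eq0 _ _ (codom a)).
- apply/allP => _ /codomP[i ->]; rewrite rootE /p !hornerE horner_sum.
  rewrite (bigD1 i)//= hornerZ horner_prod.
  under eq_bigr do rewrite hornerXsubC.
  rewrite divfK ?den_neq0//.
  rewrite big1 ?addr0 ?subrr// => k ki.
  rewrite hornerZ horner_prod (bigD1 i)//=; last by rewrite eq_sym.
  by rewrite hornerXsubC subrr mul0r mulr0.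
- by rewrite map_inj_uniq ?enum_uniq.
- rewrite size_codom card_ord /p.
  apply: (leq_trans (size_polyD _ _)); rewrite geq_max size_polyXn mn/= size_polyN.
  apply: (leq_trans (size_sum _ _ _)); apply/bigmax_leqP => k _.
  apply: (leq_trans (size_scale_leq _ _)).
  by rewrite -big_filter size_prod_XsubC size_others prednK// (leq_ltn_trans _ mn).
Qed.

(** Compare the coefficients of [X^(n-1)] in [lagrange_monomial]: every basis product is monic of
    degree [n-1]. *)
Lemma sum_lagrange m : (m < n)%N ->
  \sum_(k < n) a k ^+ m / den k = (m == n.-1)%:R.
Proof.
move=> mn; have /(congr1 (fun p : {poly F} => p`_n.-1)) := lagrange_monomial mn.
rewrite coefXn eq_sym coef_sum => ->.
apply: eq_bigr => k _; rewrite coefZ -[LHS]mulr1; congr (_ * _).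
rewrite -big_filter.
have := monic_prod_XsubC [seq j <- index_enum 'I_n | j != k] xpredT a.
by rewrite monicE /lead_coef size_prod_XsubC size_others => /eqP ->.
Qed.

(** Evaluate [lagrange_monomial] for the exponent [n-1-q] at [w^-1], multiply by [w^(n-1)], and
    divide by all the factors [1 - w a_j]. *)
Lemma partial_fractions (w : F) q : (q < n)%N -> (forall j, 1 - w * a j != 0) ->
  w ^+ q * \prod_(j < n) (1 - w * a j)^-1 =
  \sum_(k < n) a k ^+ (n.-1 - q) / den k * (1 - w * a k)^-1.
Proof.
move=> qn waj.
have n0 : (0 < n)%N by apply: leq_ltn_trans qn.
have mn : (n.-1 - q < n)%N by rewrite (leq_ltn_trans (leq_subr _ _))// prednK.
(* At [w = 0] the identity degenerates to [sum_lagrange]: both sides are 1 if [q = 0] and 0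
   otherwise. *)
have [->|w0] := eqVneq w 0.
  under [RHS]eq_bigr do rewrite mul0r subr0 invr1 mulr1.
  rewrite sum_lagrange//.
  rewrite big1 ?mulr1; last by move=> j _; rewrite mul0r subr0 invr1.
  rewrite expr0n; congr (_%:R); case: q qn {mn} => [|q] qn.
    by rewrite subn0 !eqxx.
  by congr nat_of_bool; apply/esym/negbTE; lia.
have wz j : w^-1 - a j = w^-1 * (1 - w * a j) by rewrite mulrBr mulr1 mulKf.
have /(congr1 (fun p => w ^+ n.-1 * p.[w^-1])) := lagrange_monomial mn.
have wq : w ^+ n.-1 * w^-1 ^+ (n.-1 - q) = w ^+ q.
  have {1}-> : n.-1 = (q + (n.-1 - q))%N by lia.
  by rewrite exprD exprVn mulfK ?expf_neq0.
rewrite hornerXn wq => ->.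
rewrite horner_sum mulr_sumr mulr_suml; apply: eq_bigr => k _.
have wP : w ^+ n.-1 * \prod_(j < n | j != k) (w^-1 - a j) =
    \prod_(j < n | j != k) (1 - w * a j).
  under eq_bigr do rewrite wz.
  rewrite big_split/= prodr_const cardC1 card_ord mulrA exprVn.
  by rewrite mulfV ?mul1r ?expf_neq0.
rewrite hornerZ horner_prod; under eq_bigr do rewrite hornerXsubC.
rewrite mulrCA wP -[LHS]mulrA; congr (_ * _).
rewrite [X in _ * X](bigD1 k)//= mulrCA -big_split/= big1 ?mulr1// => j _.
by rewrite mulfV.
Qed.
End Lagrange.

(** * The Fourier kernel of the spline and its derivative *)

Section ComplexKernel.
Local Open Scope complex_scope.
Context {R : realType}.
Implicit Types (f g : R -> R[i]) (s : seq R) (a x : R) (q : nat).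

(** Differentiability along the real line is stated componentwise, since the real integrals below
    use the real and imaginary parts separately. *)
Definition is_cderive f x (l : R[i]) :=
  is_derive x 1 (fun y => complex.Re (f y)) (complex.Re l) /\
  is_derive x 1 (fun y => complex.Im (f y)) (complex.Im l).

Lemma is_cderive_cst (z : R[i]) x : is_cderive (fun=> z) x 0.
Proof. by split; apply: is_derive_cst. Qed.

Lemma is_cderive_imag x : is_cderive (fun y => y *i) x 'i.
Proof. by split => /=; [exact: is_derive_cst|exact: is_derive_id]. Qed.

Lemma is_cderiveM f g x l m : is_cderive f x l -> is_cderive g x m ->
  is_cderive (fun y => f y * g y) x (l * g x + f x * m).
Proof.
case=> f1 f2 [g1 g2]; split.
- have -> : (fun y => complex.Re (f y * g y)) =
      (fun y => complex.Re (f y) * complex.Re (g y) -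
         complex.Im (f y) * complex.Im (g y)).
    by apply/funext => y; case: (f y) (g y) => ? ? [].
  apply: is_derive_eq; rewrite /GRing.scale/=.
  by case: (f x) (g x) l m {f1 f2 g1 g2} => ? ? [? ?] [? ?] [? ?] /=; ring.
- have -> : (fun y => complex.Im (f y * g y)) =
      (fun y => complex.Re (f y) * complex.Im (g y) +
         complex.Im (f y) * complex.Re (g y)).
    by apply/funext => y; case: (f y) (g y) => ? ? [].
  apply: is_derive_eq; rewrite /GRing.scale/=.
  by case: (f x) (g x) l m {f1 f2 g1 g2} => ? ? [? ?] [? ?] [? ?] /=; ring.
Qed.

Lemma is_cderiveX f x l q : is_cderive f x l ->
  is_cderive (fun y => f y ^+ q) x (q%:R * f x ^+ q.-1 * l).
Proof.
move=> fl; elim: q => [|q IHq].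
  by rewrite !mul0r; exact: is_cderive_cst.
have -> : (fun y => f y ^+ q.+1) = (fun y => f y * f y ^+ q).
  by apply/funext => y; rewrite exprS.
have -> : q.+1%:R * f x ^+ q.+1.-1 * l =
    l * f x ^+ q + f x * (q%:R * f x ^+ q.-1 * l).
  rewrite -natr1; case: q {IHq} => [|q] /=; first by rewrite !mul0r mulr0; ring.
  by rewrite exprS; ring.
exact: is_cderiveM.
Qed.

(** With [x *i] standing for [i x], this is the characteristic function at [x] of [a] times a
    standard exponential variable. *)
Definition cfactor a x : R[i] := (1 - x *i * a%:C)^-1.

Lemma cfactor_denE a x : 1 - x *i * a%:C = 1 -i* (x * a).
Proof.
by apply/eqP; rewrite eq_complex/= !(mulr0, mul0r, add0r, addr0, subr0, oppr0) !eqxx.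
Qed.

Lemma cfactor_den_neq0 a x : 1 - x *i * a%:C != 0 :> R[i].
Proof. by rewrite cfactor_denE eq_complex /= oner_eq0. Qed.

Let onesqr_neq0 x : 1 + x ^+ 2 != 0.
Proof. by apply/lt0r_neq0; have := sqr_ge0 x; lra. Qed.

Lemma cfactorE a x :
  cfactor a x = (1 + (x * a) ^+ 2)^-1 +i* (x * a / (1 + (x * a) ^+ 2)).
Proof.
apply: (mulfI (cfactor_den_neq0 a x)); rewrite mulfV ?cfactor_den_neq0//.
rewrite cfactor_denE; have := onesqr_neq0 (x * a); move: (x * a) => y y0.
by apply/eqP; rewrite eq_complex/=; apply/andP; split; apply/eqP; field.
Qed.

Lemma is_cderive_cfactor a x : is_cderive (cfactor a) x ('i * a%:C * cfactor a x ^+ 2).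
Proof.
have p y : 1 + (y * a) ^+ 2 != 0 by apply/lt0r_neq0; have := sqr_ge0 (y * a); lra.
split.
- have -> : (fun y => complex.Re (cfactor a y)) = (fun y => (1 + (y * a) ^+ 2)^-1).
    by apply/funext => y; rewrite cfactorE.
  apply: is_derive_eq; rewrite cfactorE /GRing.scale/= expr2/=.
  by have := p x; move: (x * a) => y y0; field.
- have -> : (fun y => complex.Im (cfactor a y)) = (fun y => y * a / (1 + (y * a) ^+ 2)).
    by apply/funext => y; rewrite cfactorE.
  apply: is_derive_eq; rewrite cfactorE /GRing.scale/= expr2/=.
  by have := p x; move: (x * a) => y y0; field.
Qed.

Definition cker q s x : R[i] := (x *i) ^+ q * \prod_(a <- s) cfactor a x.

Lemma cker_cons q a s x : cker q (a :: s) x = cfactor a x * cker q s x.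
Proof. by rewrite /cker big_cons mulrCA. Qed.

Lemma ckerS q s x : cker q.+1 s x = x *i * cker q s x.
Proof. by rewrite /cker exprS mulrA. Qed.

(** This is [1/(1 - w a) = 1 + w a/(1 - w a)] with [w = i x]: the leading term loses the knot, and
    the correction carries an extra [i x a]. *)
Lemma cker_shift q a s x : cker q (a :: s) x = cker q s x + a%:C * cker q.+1 (a :: s) x.
Proof.
rewrite ckerS cker_cons /cfactor.
have := cfactor_den_neq0 a x; move: (cker q s x) => z.
by move: (x *i) a%:C => w b h; field.
Qed.

(** The derivative of [(1 - i x a)^-1] is [i a (1 - i x a)^-2], so differentiation repeats a knot.
    At [q = 0] the truncated [q.-1] is harmless, because its coefficient is zero. *)
Lemma is_cderive_cker q s x : is_cderive (cker q s) x
  ('i * (q%:R * cker q.-1 s x + \sum_(a <- s) a%:C * cker q (a :: s) x)).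
Proof.
elim: s => [|a s IHs].
  rewrite big_nil addr0 /cker.
  have -> : (fun y => (y *i) ^+ q * \prod_(a <- [::]) cfactor a y) =
      (fun y => (y *i) ^+ q).
    by apply/funext => y; rewrite big_nil mulr1.
  rewrite big_nil mulr1 mulrC.
  exact/is_cderiveX/is_cderive_imag.
have -> : cker q (a :: s) = (fun y => cfactor a y * cker q s y).
  by apply/funext => y; rewrite cker_cons.
have := is_cderiveM (is_cderive_cfactor a x) IHs.
congr is_cderive.
rewrite big_cons !cker_cons.
have -> : \sum_(b <- s) b%:C * cker q [:: b, a & s] x =
    cfactor a x * (\sum_(b <- s) b%:C * cker q (b :: s) x).
  by rewrite mulr_sumr; apply: eq_bigr => b _; rewrite !cker_cons; ring.
move: (\sum_(b <- s) _) => S; ring.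
Qed.

Lemma ReD (z t : R[i]) : complex.Re (z + t) = complex.Re z + complex.Re t.
Proof. by case: z t => ? ? []. Qed.

Lemma Re_sum (I : Type) (r : seq I) (F : I -> R[i]) :
  complex.Re (\sum_(i <- r) F i) = \sum_(i <- r) complex.Re (F i).
Proof. exact: (@big_morph _ _ (@complex.Re R) 0 +%R 0 +%R ReD). Qed.

Lemma ReZ a (z : R[i]) : complex.Re (a%:C * z) = a * complex.Re z.
Proof. by case: z => u v /=; rewrite mul0r subr0. Qed.

(** The kernel at [- x] is the conjugate of the kernel at [x], so its imaginary part is odd and its
    integral over the line is that of the real part. *)
Definition rker q s x : R := complex.Re (cker q s x).
Definition iker q s x : R := complex.Im (cker q s x).

Lemma rker_shift q a s x : rker q (a :: s) x = rker q s x + a * rker q.+1 (a :: s) x.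
Proof.
by rewrite /rker cker_shift ReD ReZ.
Qed.

(** The factor [i] in [is_cderive_cker] turns the derivative of the imaginary part into real parts.
    Thus [iker] is an antiderivative for a relation among the real kernels alone. *)
Lemma is_derive_iker q s x : is_derive x 1 (iker q s)
  (q%:R * rker q.-1 s x + \sum_(a <- s) a * rker q (a :: s) x).
Proof.
have [_] := is_cderive_cker q s x.
congr (is_derive _ _ _ _).
have -> : q%:R = (q%:R)%:C :> R[i] by rewrite rmorph_nat.
rewrite mulrC ImiRe.
rewrite ReD ReZ Re_sum; congr (_ + _); apply: eq_bigr => a _; exact: ReZ.
Qed.

Lemma continuous_rker q s : continuous (rker q s).
Proof.
move=> x; have [d _] := is_cderive_cker q s x.
apply: differentiable_continuous; apply/derivable1_diffP.
exact: (@ex_derive _ _ _ _ _ _ _ d).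
Qed.

Let sqn (z : R[i]) := complex.Re z ^+ 2 + complex.Im z ^+ 2.

Let sqnM z t : sqn (z * t) = sqn z * sqn t.
Proof. by case: z t => ? ? [? ?]; rewrite /sqn/=; ring. Qed.

Lemma cker_sqn q s x : rker q s x ^+ 2 + iker q s x ^+ 2 =
  (x ^+ 2) ^+ q * \prod_(a <- s) (1 + (x * a) ^+ 2)^-1.
Proof.
rewrite -[LHS]/(sqn _) sqnM; congr (_ * _).
  elim: q => [|q IHq]; first by rewrite /sqn/= expr1n expr0n/= addr0 expr0.
  rewrite [(x *i) ^+ _]exprS sqnM IHq [RHS]exprS; congr (_ * _).
  by rewrite /sqn/= expr0n/= add0r.
elim: s => [|a s IHs]; first by rewrite !big_nil /sqn/= expr1n expr0n/= addr0.
rewrite !big_cons sqnM IHs; congr (_ * _).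
rewrite cfactorE /sqn/=; have := onesqr_neq0 (x * a).
by move: (x * a) => y y0; field.
Qed.

End ComplexKernel.

(** * Bounds and recurrences for the kernel integrals *)

Section KernelIntegral.
Context {R : realType}.
Implicit Types (s : seq R) (a x sg : R) (q : nat).

(* The tangent line of the exponential at [r * L], evaluated at [L] and at [0]. *)
Lemma expR_bernoulli (r Y : R) : 0 <= r <= 1 -> 0 <= Y ->
  expR (r * ln (1 + Y)) <= 1 + r * Y.
Proof.
move=> /andP[r0 r1] Y0; set L := ln _.
have EL : expR L = 1 + Y by rewrite lnK// posrE; lra.
set E := expR (r * L).
have h1 : E * (1 + (1 - r) * L) <= 1 + Y.
  have -> : 1 + Y = E * expR ((1 - r) * L).
    by rewrite -expRD -EL; congr expR; ring.
  by rewrite ler_pM2l ?expR_gt0// expR_ge1Dx.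
have h2 : E * (1 - r * L) <= 1.
  have {2}-> : 1 = E * expR (- (r * L)) :> R by rewrite -expRD subrr expR0.
  by rewrite ler_pM2l ?expR_gt0// expR_ge1Dx.
have h3 : 0 <= r * (1 + Y - E * (1 + (1 - r) * L)) by rewrite mulr_ge0// subr_ge0.
have h4 : 0 <= (1 - r) * (1 - E * (1 - r * L)) by rewrite mulr_ge0// subr_ge0.
have -> : 1 + r * Y = r * (1 + Y - E * (1 + (1 - r) * L)) +
   (1 - r) * (1 - E * (1 - r * L)) + E by ring.
by lra.
Qed.

(** No knot carries more than the fraction [1/M] of [sg^2], while together they carry at least
    [sg^2]. Hence the product of the factors decays like a power of order [M]. The last condition is
    an inequality, so that it survives the addition of knots. *)
Definition spread (M : nat) sg s :=
  [/\ 0 < sg, (forall a, a \in s -> M%:R * a ^+ 2 <= sg ^+ 2)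
    & sg ^+ 2 <= \sum_(a <- s) a ^+ 2].

Lemma spreadW M N sg s : (N <= M)%N -> spread M sg s -> spread N sg s.
Proof.
move=> NM [sg0 h1 h2]; split => // a /h1; apply: le_trans.
by rewrite ler_wpM2r ?sqr_ge0// ler_nat.
Qed.

Lemma spread_cons M sg a s : M%:R * a ^+ 2 <= sg ^+ 2 -> spread M sg s ->
  spread M sg (a :: s).
Proof.
move=> ha [sg0 h1 h2]; split => // [b|].
  by rewrite inE => /predU1P[->//|/h1].
by rewrite big_cons (le_trans h2)// lerDr sqr_ge0.
Qed.

(** With [Y = (sg x)^2 / M] each factor is [1 + r Y], where [r = M a^2 / sg^2] lies in [[0, 1]]. By
    [expR_bernoulli] it is at least [(1 + Y)^r], and the exponents [r] add up to at least [M]. *)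
Lemma spread_prod_ge M sg s x : (0 < M)%N -> spread M sg s ->
  (1 + (sg * x) ^+ 2 / M%:R) ^+ M <= \prod_(a <- s) (1 + (x * a) ^+ 2).
Proof.
move=> M0 [sg0 h1 h2]; set Y := _ / _.
have M0' : 0 < M%:R :> R by rewrite ltr0n.
have sg2 : 0 < sg ^+ 2 by rewrite exprn_gt0.
have Y0 : 0 <= Y by rewrite divr_ge0 ?sqr_ge0// ltW.
pose r a := M%:R * a ^+ 2 / sg ^+ 2.
have rY a : 1 + (x * a) ^+ 2 = 1 + r a * Y.
  by rewrite /r /Y; congr (_ + _); field; rewrite !lt0r_neq0.
have L0 : 0 <= ln (1 + Y) by rewrite ln_ge0// lerDl.
have -> : (1 + Y) ^+ M = expR (M%:R * ln (1 + Y)).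
  by rewrite expRM_natl lnK// posrE; lra.
apply: (@le_trans _ _ (\prod_(a <- s) expR (r a * ln (1 + Y)))).
  rewrite -expR_sum ler_expR -mulr_suml ler_wpM2r//.
  by rewrite /r -mulr_suml -mulr_sumr ler_pdivlMr// ler_pM2l.
rewrite big_seq [leRHS]big_seq; apply: ler_prod => a sa.
rewrite expR_ge0/= rY expR_bernoulli//.
rewrite /r (divr_ge0 (mulr_ge0 (ltW M0') (sqr_ge0 a)) (ltW sg2))/=.
by rewrite ler_pdivrMr// mul1r; exact: h1.
Qed.

Let c q : R := Num.sqrt q.+2%:R.

Let c_gt0 q : 0 < c q. Proof. by rewrite sqrtr_gt0. Qed.

(** Take [M = q + 2] and [Y = (sg x)^2 / M]: then [x^(2 q)] is [(c q / sg)^(2 q) Y^q], and the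
    product contributes at most [(1 + Y)^-(q + 2)]. Since [Y <= 1 + Y], a factor [(1 + Y)^-2]
    remains, which makes the kernel itself integrable. *)
Lemma cker_bound q s sg x : spread q.+2 sg s ->
  rker q s x ^+ 2 + iker q s x ^+ 2 <=
  ((c q / sg) ^+ q / (1 + (sg / c q * x) ^+ 2)) ^+ 2.
Proof.
move=> Hs; have [sg0 _ _] := Hs.
rewrite cker_sqn.
have c2 : c q ^+ 2 = q.+2%:R by rewrite sqr_sqrtr.
have cn0 := lt0r_neq0 (c_gt0 q); have sgn0 := lt0r_neq0 sg0.
have -> : (sg / c q * x) ^+ 2 = (sg * x) ^+ 2 / q.+2%:R by rewrite -c2; field.
set Y := _ / q.+2%:R.
have Y0 : 0 <= Y by rewrite divr_ge0 ?sqr_ge0.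
have Y1 : 0 < 1 + Y by lra.
have -> : x ^+ 2 = (c q / sg) ^+ 2 * Y by rewrite /Y -c2; field; rewrite cn0 sgn0.
have -> : ((c q / sg) ^+ q / (1 + Y)) ^+ 2 = ((c q / sg) ^+ 2) ^+ q * (1 + Y) ^- 2.
  by rewrite expr_div_n exprAC.
rewrite exprMn -mulrA ler_wpM2l ?(exprn_ge0 _ (sqr_ge0 _))//.
have := spread_prod_ge x (ltn0Sn _) Hs; rewrite -/Y => HP.
have P0 : 0 < \prod_(a <- s) (1 + (x * a) ^+ 2).
  by apply: lt_le_trans HP; rewrite exprn_gt0.
rewrite prodfV ler_pdivrMr// mulrC ler_pdivlMr ?exprn_gt0//.
apply: le_trans HP; rewrite -[q.+2]addn2 exprD ler_wpM2r ?sqr_ge0//.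
by rewrite lerXn2r ?nnegrE//; lra.
Qed.

Let ker_bound0 q sg x : 0 < sg -> 0 <= (c q / sg) ^+ q / (1 + (sg / c q * x) ^+ 2).
Proof.
move=> sg0; rewrite divr_ge0 ?exprn_ge0 ?divr_ge0 ?sqrtr_ge0 ?(ltW sg0)//.
by have := sqr_ge0 (sg / c q * x); lra.
Qed.

Lemma rker_bound q s sg x : spread q.+2 sg s ->
  `|rker q s x| <= (c q / sg) ^+ q / (1 + (sg / c q * x) ^+ 2).
Proof.
move=> Hs; have [sg0 _ _] := Hs; have B0 := ker_bound0 q x sg0.
rewrite -(@ler_pXn2r _ 2)// ?nnegrE// real_normK ?num_real//.
by have := cker_bound x Hs; have := sqr_ge0 (iker q s x); lra.
Qed.

Lemma iker_bound q s sg x : spread q.+2 sg s ->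
  `|iker q s x| <= (c q / sg) ^+ q / (1 + (sg / c q * x) ^+ 2).
Proof.
move=> Hs; have [sg0 _ _] := Hs; have B0 := ker_bound0 q x sg0.
rewrite -(@ler_pXn2r _ 2)// ?nnegrE// real_normK ?num_real//.
by have := cker_bound x Hs; have := sqr_ge0 (rker q s x); lra.
Qed.

Lemma integrable_rker q s sg : spread q.+2 sg s -> integrableR (rker q s).
Proof.
move=> Hs; have [sg0 _ _] := Hs.
apply: (@integrableRP _ _ ((c q / sg) ^+ q) (sg / c q)).
- by rewrite divr_gt0.
- exact: continuous_rker.
- by move=> x; exact: rker_bound.
Qed.

Definition kint q s := integralR (rker q s).

Lemma kint_bound q s sg : spread q.+2 sg s ->
  sg ^+ q.+1 * `|kint q s| <= pi * c q ^+ q.+1.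
Proof.
move=> Hs; have [sg0 _ _] := Hs.
have cn0 := lt0r_neq0 (c_gt0 q); have sgn0 := lt0r_neq0 sg0.
have := @le_integralR _ _ ((c q / sg) ^+ q) (sg / c q) (divr_gt0 sg0 (c_gt0 q))
  (continuous_rker (s := s)) (fun x => rker_bound x Hs).
rewrite -(ler_pM2l (exprn_gt0 q.+1 sg0)) => /le_trans; apply.
rewrite expr_div_n !exprS le_eqVlt; apply/orP; left; apply/eqP.
by field; rewrite expf_neq0 ?cn0 ?sgn0.
Qed.

Lemma kint_shift q a s sg : spread q.+3 sg (a :: s) -> spread q.+2 sg s ->
  kint q (a :: s) = kint q s + a * kint q.+1 (a :: s).
Proof.
move=> Has Hs.
rewrite /kint /integralR -RintegralZl//; last exact: (integrable_rker Has).
rewrite -RintegralD//.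
- by apply: eq_Rintegral => x _; rewrite rker_shift.
- exact: (integrable_rker Hs).
- exact: (integrableZl _ a (integrable_rker Has)).
Qed.

Lemma continuous_sum_rker q s r :
  continuous (fun x => \sum_(a <- r) a * rker q (a :: s) x).
Proof.
elim: r => [|a r IHr].
  have -> : (fun x => \sum_(a <- [::]) a * rker q (a :: s) x) = cst 0.
    by apply/funext => x; rewrite big_nil.
  by move=> x; exact: cvg_cst.
have -> : (fun x => \sum_(b <- a :: r) b * rker q (b :: s) x) =
   (fun x => a * rker q (a :: s) x + \sum_(b <- r) b * rker q (b :: s) x).
  by apply/funext => x; rewrite big_cons.
move=> x; apply: cvgD; last exact: IHr.
by apply: cvgM; [exact: cvg_cst|exact: continuous_rker].
Qed.

Lemma kint_sum q s r sg : spread q.+2 sg s ->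
  (forall a, a \in r -> q.+2%:R * a ^+ 2 <= sg ^+ 2) ->
  integrableR (fun x => \sum_(a <- r) a * rker q (a :: s) x) /\
  integralR (fun x => \sum_(a <- r) a * rker q (a :: s) x) =
  \sum_(a <- r) a * kint q (a :: s).
Proof.
move=> Hs; elim: r => [_|a r IHr ar].
  rewrite big_nil; have -> : (fun x => \sum_(a <- [::]) a * rker q (a :: s) x) = cst 0.
    by apply/funext => x; rewrite big_nil.
  split; first exact: integrable0.
  by rewrite /integralR Rintegral_cst// mul0r.
have [|ir Er] := IHr; first by move=> b br; apply: ar; rewrite inE br orbT.
have Ha : spread q.+2 sg (a :: s).
  by apply: spread_cons => //; apply: ar; rewrite mem_head.
have ia := integrable_rker Ha.
have -> : (fun x => \sum_(b <- a :: r) b * rker q (b :: s) x) =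
   (fun x => a * rker q (a :: s) x + \sum_(b <- r) b * rker q (b :: s) x).
  by apply/funext => x; rewrite big_cons.
have ia' : integrableR (fun x => a * rker q (a :: s) x) by exact: (integrableZl _ a ia).
split; first exact: (integrableD _ ia' ir).
by rewrite /integralR RintegralD// RintegralZl// big_cons -Er.
Qed.

(** The left side is the integral of the derivative of [iker q s], which tends to zero at both ends
    by [iker_bound]. *)
Lemma kint_by_parts q s sg : spread q.+2 sg s ->
  q%:R * kint q.-1 s + \sum_(a <- s) a * kint q (a :: s) = 0.
Proof.
move=> Hs; have [sg0 sa _] := Hs.
have [iS ES] := kint_sum Hs sa.
have Hq : spread q.-1.+2 sg s by apply: spreadW Hs; lia.
have iq := integrable_rker Hq.
rewrite -ES /kint /integralR -RintegralZl// -RintegralD//; last first.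
  exact: (integrableZl _ _ iq).
apply: (@integralR_FTC _ (iker q s)).
- exact: (integrableD _ (integrableZl _ _ iq) iS).
- move=> x; apply: cvgD; first by apply: cvgM; [exact: cvg_cst|exact: continuous_rker].
  exact: continuous_sum_rker.
- by move=> x; exact: is_derive_iker.
- pose b := sg / c q; have b0 : 0 < b by rewrite divr_gt0.
  pose K := (c q / sg) ^+ q.
  have cvB : (fun n : nat => K / (1 + (b * n%:R) ^+ 2)) @ \oo --> 0.
    rewrite -[0](mulr0 K); apply: cvgM; first exact: cvg_cst.
    apply/gtr0_cvgV0.
      by apply: nearW => n; have := sqr_ge0 (b * n%:R); lra.
    apply: (@ger_cvgy _ _ _ _ (fun n : nat => b * n%:R)).
      apply: nearW => n; have := sqr_ge0 (b * n%:R - 1); rewrite sqrrB.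
      by have := sqr_ge0 (b * n%:R); lra.
    apply: (@cvg_comp _ _ _ (fun n : nat => n%:R : R) (fun r => b * r)).
      exact: cvgr_idn.
    by apply: gt0_cvgMry => //; exact: cvg_id.
  have K1 : (fun n : nat => iker q s n%:R) @ \oo --> 0.
    apply: (@squeeze_cvgr _ _ _ _ (fun n : nat => - (K / (1 + (b * n%:R) ^+ 2)))
      (fun n : nat => (K / (1 + (b * n%:R) ^+ 2)))) => //.
      by apply: nearW => n; rewrite -ler_norml; exact: iker_bound.
    by rewrite -oppr0; exact: cvgN.
  have K2 : (fun n : nat => iker q s (- n%:R)) @ \oo --> 0.
    apply: (@squeeze_cvgr _ _ _ _ (fun n : nat => - (K / (1 + (b * n%:R) ^+ 2)))
      (fun n : nat => (K / (1 + (b * n%:R) ^+ 2)))) => //.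
      apply: nearW => n; rewrite -ler_norml -[(b * _) ^+ 2]sqrrN -mulrN.
      exact: iker_bound.
    by rewrite -oppr0; exact: cvgN.
  by rewrite -(subr0 0); exact: (cvgB K1 K2).
Qed.

(** Applying [kint_shift] to each term of [kint_by_parts] splits off the sum of the knots as a
    common factor. *)
Lemma kint_rec q s sg : spread q.+3 sg s ->
  - (\sum_(a <- s) a) * kint q s =
  q%:R * kint q.-1 s + \sum_(a <- s) a ^+ 2 * kint q.+1 (a :: s).
Proof.
move=> Hs; have Hs' : spread q.+2 sg s by apply: spreadW Hs.
have [_ ha _] := Hs.
have := kint_by_parts Hs'.
have -> : \sum_(a <- s) a * kint q (a :: s) =
   (\sum_(a <- s) a) * kint q s + \sum_(a <- s) a ^+ 2 * kint q.+1 (a :: s).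
  rewrite mulr_suml -big_split/= big_seq [RHS]big_seq; apply: eq_bigr => a sa.
  rewrite (@kint_shift q a s sg)//; first by ring.
  by apply: spread_cons => //; exact: ha.
by move=> H; apply/eqP; rewrite -subr_eq0 -oppr_eq0; apply/eqP; rewrite -[RHS]H; ring.
Qed.

End KernelIntegral.

(** * Polynomial decay in the sum of the knots *)

Section Decay.
Context {R : realType}.
Implicit Types (s l : seq R) (a x sg : R) (p q m : nat).

Lemma spread_abs_le M sg s a : (0 < M)%N -> spread M sg s -> a \in s -> `|a| <= sg.
Proof.
move=> M0 [sg0 h _] /h ha.
rewrite -(@ler_pXn2r _ 2)// ?nnegrE ?(ltW sg0)// real_normK ?num_real//.
by apply: le_trans ha; rewrite ler_peMl ?sqr_ge0// ler1n.
Qed.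

Lemma ler_norm_sum_seq (r : seq R) (F G : R -> R) :
  (forall a, a \in r -> `|F a| <= G a) -> `|\sum_(a <- r) F a| <= \sum_(a <- r) G a.
Proof.
move=> FG; rewrite big_seq [leRHS]big_seq.
by apply: (le_trans (ler_norm_sum _ _ _)); apply: ler_sum.
Qed.

(** Induction on [p]: [kint_rec] trades one factor [sum s] for three kinds of terms covered by the
    case [p]. One kind carries an additional repeated knot, so repeated knots are collected in [l]
    and counted by [m]. The powers of [sg] make the estimate homogeneous under scaling of the
    knots. *)
Lemma kint_decay p q m : exists2 C, 0 <= C & forall l s sg,
  spread (p + q).+2 sg (l ++ s) -> (size l <= m)%N ->
  \sum_(a <- s) a ^+ 2 <= sg ^+ 2 ->
  `|\sum_(a <- s) a| ^+ p * (sg ^+ q.+1 * `|kint q (l ++ s)|) <= C * sg ^+ p.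
Proof.
elim: p q m => [|p IHp] q m.
  exists (pi * Num.sqrt q.+2%:R ^+ q.+1); first by rewrite mulr_ge0 ?pi_ge0 ?exprn_ge0.
  by move=> l s sg Hs _ _; rewrite expr0 mul1r mulr1; exact: kint_bound.
have [C1 C10 H1] := IHp q m.
have [C2 C20 H2] := IHp q.-1 m.
have [C3 C30 H3] := IHp q.+1 m.+1.
have leq0 : (q.+3 <= (p.+1 + q).+2)%N by lia.
have leq1 : ((p + q).+2 <= (p.+1 + q).+2)%N by lia.
have leq2 : ((p + q.-1).+2 <= (p.+1 + q).+2)%N by lia.
exists (m%:R * C1 + q%:R * C2 + m.+1%:R * C3).
  by rewrite !addr_ge0// mulr_ge0.
move=> l s sg Hs lm s2.
have [sg0 ha _] := Hs.
have sgn0 := lt0r_neq0 sg0.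
pose T := `|\sum_(a <- s) a|; rewrite -/T.
have T0 : 0 <= T by exact: normr_ge0.
have [A AE] : {A | A = T ^+ p * sg ^+ q.+1} by eexists.
have A0 : 0 <= A by rewrite AE mulr_ge0 ?exprn_ge0 ?(ltW sg0).
have Hrec := @kint_rec _ q (l ++ s) sg (spreadW leq0 Hs).
have l1 : `|\sum_(a <- l) a| <= m%:R * sg.
  apply: (le_trans (@ler_norm_sum_seq l id (fun=> sg) _)).
    move=> a al; apply: (spread_abs_le (ltn0Sn _) Hs).
    by rewrite mem_cat al.
  rewrite big_const_seq count_predT iter_addr_0 -[sg *+ _]mulr_natl.
  by rewrite ler_wpM2r ?(ltW sg0)// ler_nat.
have l2 : \sum_(a <- l ++ s) a ^+ 2 <= m.+1%:R * sg ^+ 2.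
  rewrite big_cat/= -natr1 mulrDl mul1r lerD//.
  apply: (@le_trans _ _ (\sum_(a <- l) sg ^+ 2)).
    rewrite big_seq [leRHS]big_seq; apply: ler_sum => a al.
    rewrite -real_normK ?num_real// lerXn2r ?nnegrE ?(ltW sg0)//.
    by apply: (spread_abs_le (ltn0Sn _) Hs); rewrite mem_cat al.
  rewrite big_const_seq count_predT iter_addr_0 -[_ *+ size l]mulr_natl.
  by rewrite ler_wpM2r ?sqr_ge0// ler_nat.
have E1 : A * `|kint q (l ++ s)| <= C1 * sg ^+ p.
  by rewrite AE -mulrA; exact: (H1 l s sg (spreadW leq1 Hs) lm s2).
have E2 : A * (q%:R * `|kint q.-1 (l ++ s)|) <= q%:R * C2 * sg ^+ p.+1.
  (* At [q = 0] the coefficient vanishes; otherwise [q.-1.+1 = q], and one power of [sg] is left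
     over. *)
  have [->|q0] := eqVneq q 0%N; first by rewrite !mul0r mulr0.
  have qE : q = q.-1.+1 by rewrite prednK// lt0n.
  have := H2 l s sg (spreadW leq2 Hs) lm s2.
  rewrite -/T -qE => H.
  rewrite AE mulrCA -[leRHS]mulrA ler_wpM2l//.
  have -> : T ^+ p * sg ^+ q.+1 * `|kint q.-1 (l ++ s)| =
    sg * (T ^+ p * (sg ^+ q * `|kint q.-1 (l ++ s)|)) by rewrite exprS; ring.
  have -> : C2 * sg ^+ p.+1 = sg * (C2 * sg ^+ p) by rewrite exprS; ring.
  by rewrite ler_wpM2l// ltW.
have E3 : A * `|\sum_(a <- l ++ s) a ^+ 2 * kint q.+1 (a :: l ++ s)| <=
    m.+1%:R * C3 * sg ^+ p.+1.
  have -> : m.+1%:R * C3 * sg ^+ p.+1 = m.+1%:R * sg ^+ 2 * (C3 * sg ^+ p / sg).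
    by rewrite exprS; field.
  apply: (@le_trans _ _
    ((\sum_(a <- l ++ s) a ^+ 2) * (C3 * sg ^+ p / sg))); last first.
    by rewrite ler_wpM2r// divr_ge0 ?mulr_ge0 ?exprn_ge0 ?(ltW sg0).
  rewrite mulr_suml -(ger0_norm A0) -normrM mulr_sumr.
  apply: ler_norm_sum_seq => a als.
  rewrite normrM (ger0_norm A0) [X in _ * X]normrM (ger0_norm (sqr_ge0 a)).
  rewrite mulrCA ler_wpM2l ?sqr_ge0//.
  rewrite ler_pdivlMr//.
  have -> : A * `|kint q.+1 (a :: l ++ s)| * sg =
    T ^+ p * (sg ^+ q.+2 * `|kint q.+1 (a :: l ++ s)|).
    by rewrite AE [sg ^+ q.+2]exprS; ring.
  apply: (H3 (a :: l) s sg) => //=.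
  by rewrite addnS -addSn; apply: spread_cons => //; exact: ha.
(* The recurrence involves the sum over [l ++ s], whereas the weight is the sum over [s] alone; the
   difference, the sum over [l], is at most [m sg]. *)
have F : T * `|kint q (l ++ s)| <= `|\sum_(a <- l) a| * `|kint q (l ++ s)| +
   q%:R * `|kint q.-1 (l ++ s)| +
   `|\sum_(a <- l ++ s) a ^+ 2 * kint q.+1 (a :: l ++ s)|.
  have -> : T * `|kint q (l ++ s)| =
      `|(\sum_(a <- s) a) * kint q (l ++ s)| by rewrite normrM.
  have -> : (\sum_(a <- s) a) * kint q (l ++ s) =
    - ((\sum_(a <- l) a) * kint q (l ++ s)) -
    (- (\sum_(a <- l ++ s) a) * kint q (l ++ s)).
    by rewrite big_cat/=; ring.
  rewrite Hrec.
  apply: (le_trans (ler_normB _ _)); rewrite normrN normrM -addrA lerD2l.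
  by apply: (le_trans (ler_normD _ _)); rewrite normrM normr_nat.
have -> : T ^+ p.+1 * (sg ^+ q.+1 * `|kint q (l ++ s)|) = A * (T * `|kint q (l ++ s)|).
  by rewrite AE [T ^+ p.+1]exprS; ring.
apply: (le_trans (ler_wpM2l A0 F)).
rewrite !mulrDr !mulrDl; apply: lerD => //; apply: lerD => //.
rewrite mulrCA.
apply: (@le_trans _ _ (m%:R * sg * (C1 * sg ^+ p))).
  by rewrite ler_pM// mulr_ge0.
by rewrite exprS le_eqVlt; apply/orP; left; apply/eqP; ring.
Qed.

End Decay.

(** * Kernel integrals as divided differences of truncated powers *)

Section Spline.
Context {R : realType} {n : nat}.
Variable a : 'I_n -> R.
Hypothesis inj_a : injective a.

Definition knots (b : 'I_n -> R) := [seq b k | k <- index_enum 'I_n].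

(** For distinct nodes this is the divided difference of order [n-1] of the truncated power
    [y -> y_+^m]. *)
Definition divdiff (m : nat) (b : 'I_n -> R) : R :=
  \sum_(k < n) pospow (b k) m / \prod_(j < n | j != k) (b k - b j).

Let den k := \prod_(j < n | j != k) (a k - a j).

Lemma rker_partial_fractions q x : (q < n)%N ->
  rker q (knots a) x = \sum_(k < n) a k ^+ (n.-1 - q) / den k / (1 + (a k * x) ^+ 2).
Proof.
move=> qn; rewrite /rker /cker big_map.
pose ac k := ((a k)%:C)%C.
have inj_ac : injective ac by move=> i j /complexI/inj_a.
rewrite [X in complex.Re X](partial_fractions inj_ac qn
  (fun j => cfactor_den_neq0 (a j) x)).
rewrite Re_sum; apply: eq_bigr => k _.
have -> : ac k ^+ (n.-1 - q) / \prod_(j < n | j != k) (ac k - ac j) =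
   ((a k ^+ (n.-1 - q) / den k)%:C)%C.
  rewrite rmorphM/= rmorphXn/= fmorphV rmorph_prod/=; congr (_ * _^-1).
  by apply: eq_bigr => j _; rewrite rmorphB.
by rewrite ReZ -/(cfactor (a k) x) cfactorE/= [x * _]mulrC.
Qed.

Lemma is_derive_sum_seq (I : Type) (r : seq I) (F G : I -> R -> R) (x : R) :
  (forall i, is_derive x 1 (F i) (G i x)) ->
  is_derive x 1 (fun y => \sum_(i <- r) F i y) (\sum_(i <- r) G i x).
Proof.
move=> FG; elim: r => [|i r IHr].
  rewrite big_nil (_ : (fun _ => _) = cst 0); first exact: is_derive_cst.
  by apply/funext => y; rewrite big_nil.
rewrite big_cons (_ : (fun _ => _) = (F i \+ (fun y => \sum_(i <- r) F i y))).
  exact: is_deriveD.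
by apply/funext => y; rewrite big_cons.
Qed.

Lemma cvg_sum_seq (I : Type) (r : seq I) (F : I -> nat -> R) (l : I -> R) :
  (forall i, F i @ \oo --> l i) ->
  (fun k : nat => \sum_(i <- r) F i k) @ \oo --> \sum_(i <- r) l i.
Proof.
move=> Fl; elim: r => [|i r IHr].
  rewrite big_nil (_ : (fun _ => _) = cst 0); first exact: cvg_cst.
  by apply/funext => y; rewrite big_nil.
rewrite big_cons (_ : (fun _ => _) = (F i \+ (fun y => \sum_(i <- r) F i y))).
  by apply: cvgD.
by apply/funext => y; rewrite big_cons.
Qed.

(** Positivity of [m] matters: [pospow y 0] is 1 even for [y <= 0], where the identity would
    fail. *)
Lemma pospow_sg (y : R) m : (0 < m)%N -> y ^+ m * Num.sg y = 2 * pospow y m - y ^+ m.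
Proof.
move=> m0; rewrite /pospow; have [y0|y0|->] := ltrgt0P y.
- by rewrite gtr0_sg// mulr1 mulr_natl mulr2n addrK.
- by rewrite ltr0_sg// mulrN1 expr0n (gtn_eqF m0) mulr0 sub0r.
- by rewrite expr0n (gtn_eqF m0) mul0r mulr0 subr0.
Qed.

(* The antiderivative of each partial fraction is an arctangent, so the integral
   is a sum over the signs of the knots; [sum_lagrange] turns signs into positive
   parts. *)
Lemma kint_divdiff q sg : (q.+2 < n)%N -> spread q.+2 sg (knots a) ->
  kint q (knots a) = 2 * pi * divdiff (n - 2 - q) a.
Proof.
move=> qn Hs.
have m1 : (n.-1 - q = (n - 2 - q).+1)%N by lia.
pose F x := \sum_(k < n) a k ^+ (n - 2 - q) / den k * atan (a k * x).
apply: (@integralR_FTC _ F).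
- exact: integrable_rker Hs.
- exact: continuous_rker.
- move=> x; rewrite rker_partial_fractions; last by lia.
  apply: (@is_derive_sum_seq _ _
    (fun k x => a k ^+ (n - 2 - q) / den k * atan (a k * x))
    (fun k x => a k ^+ (n.-1 - q) / den k / (1 + (a k * x) ^+ 2))) => k.
  apply: is_derive_eq.
  rewrite /GRing.scale/= !(mulr0, mul0r, add0r, addr0, mulr1) m1 [a k ^+ _.+1]exprSr.
  by ring.
- have -> : 2 * pi * divdiff (n - 2 - q) a =
      \sum_(k < n) a k ^+ (n - 2 - q) / den k * (Num.sg (a k) * pi).
    (* The exponent [n - 2 - q] lies strictly between 0 and [n - 1], so the plain powers sum to zero
       and [pospow_sg] applies. *)
    have L := @sum_lagrange _ _ a inj_a (n - 2 - q) ltac:(lia).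
    transitivity (pi * \sum_(k < n)
       (2 * pospow (a k) (n - 2 - q) / den k - a k ^+ (n - 2 - q) / den k)).
      rewrite sumrB L (_ : (_ == _) = false) ?subr0; last by lia.
      rewrite -mulrA mulrCA mulr_sumr; congr (_ * _); apply: eq_bigr => k _.
      by rewrite mulrA.
    rewrite mulr_sumr; apply: eq_bigr => k _.
    rewrite -mulrBl -pospow_sg; last by lia.
    by ring.
  have -> : (fun k : nat => F k%:R - F (- k%:R)) = (fun k : nat => \sum_(i < n)
     a i ^+ (n - 2 - q) / den i * (atan (a i * k%:R) - atan (a i * - k%:R))).
    apply/funext => k; rewrite -sumrB; apply: eq_bigr => i _.
    by rewrite mulrBr.
  apply: cvg_sum_seq => i; apply: cvgM; [exact: cvg_cst|exact: cvg_atan_diff].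
Qed.

End Spline.

(** * Derivatives of truncated powers *)

Section PosPow.
Context {R : realType}.
Implicit Types (f : R -> R) (x y l : R).

(** A remainder of size [h^2] handles the function [y_+^2] uniformly, including at its break point
    0. *)
Lemma is_derive_quadratic f x l :
  (forall h, `|f (h + x) - f x - h * l| <= h ^+ 2) -> is_derive x 1 f l.
Proof.
move=> fl.
have H : (fun h => h^-1 *: (f (h *: 1 + x) - f x)) @ 0^' --> l.
  apply/cvgrPdist_le => e e0; near=> h.
  have h0 : h != 0 by near: h; exact: nbhs_dnbhs_neq.
  have -> : l - h^-1 *: (f (h *: 1 + x) - f x) = - (h^-1 * (f (h + x) - f x - h * l)).
    by rewrite /GRing.scale/= mulr1; field.
  rewrite normrN normrM normfV ler_pdivrMl ?normr_gt0//.
  apply: (le_trans (fl h)); rewrite -real_normK ?num_real// expr2.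
  rewrite ler_wpM2l//.
  near: h; apply: dnbhs0_le => //.
apply: DeriveDef; first by apply/cvg_ex; exists l.
exact/cvg_lim.
Unshelve. all: by end_near. Qed.

Lemma pospowS y m : pospow y m.+1 = Num.max y 0 * pospow y m.
Proof. by rewrite /pospow exprS. Qed.

(** The exponent starts at 2, because [y_+] has a corner at 0. Higher exponents follow from the
    product rule, as [y_+^(m+3) = y * y_+^(m+2)]. *)
Lemma is_derive_pospow y m :
  is_derive y 1 (fun z => pospow z m.+2) (m.+2%:R * pospow y m.+1).
Proof.
elim: m => [|m IHm].
  apply: is_derive_quadratic => h; rewrite /pospow expr1.
  rewrite ler_norml; have := sqr_ge0 h; have := sqr_ge0 y; have := sqr_ge0 (y + h).
  have [y0|y0] := leP y 0; have [hy|hy] := leP (h + y) 0;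
    rewrite ?(expr0n, mulr0, subr0, sub0r)/=.
  - by move=> *; apply/andP; split; lra.
  - by move=> *; apply/andP; split; nra.
  - by move=> *; apply/andP; split; nra.
  - by move=> *; apply/andP; split; nra.
have E (z : R) : pospow z m.+3 = z * pospow z m.+2.
  rewrite pospowS /pospow; have [z0|z0] := leP z 0 => //.
  by rewrite expr0n/= !mulr0.
have -> : (fun z : R => pospow z m.+3) = (fun z => z * pospow z m.+2).
  by apply/funext => z; exact: E.
apply: is_derive_eq.
rewrite /GRing.scale/= mulr1.
have -> : y * (m.+2%:R * pospow y m.+1) = m.+2%:R * pospow y m.+2.
  rewrite mulrCA; congr (_ * _); rewrite [RHS]pospowS /pospow.
  by have [z0|z0] := leP y 0 => //; rewrite expr0n/= !mulr0.
by rewrite -[m.+3%:R]natr1; ring.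
Qed.

End PosPow.

(** * Standardized knots and their translates *)

Section Standardized.
Context {R : realType}.
Implicit Types (M p q m : nat) (t : R).

(** The last two conditions give half of the [spread] budget to the knots [x k] and half to the
    shift [t / n]. *)
Definition standardized M n (x : 'I_n -> R) :=
  [/\ injective x, \sum_(k < n) x k = 0, \sum_(k < n) x k ^+ 2 = 1,
      (forall k, 2 * M%:R * x k ^+ 2 <= 1) & (2 * M <= n)%N].

Definition recenter n (x : 'I_n -> R) t (k : 'I_n) : R := x k - t / n%:R.

Definition abs3 n (x : 'I_n -> R) : R := \sum_(k < n) `|x k| ^+ 3.

Definition sigma n t : R := Num.sqrt (1 + t ^+ 2 / n%:R).

Lemma recenter_inj n (x : 'I_n -> R) t : injective x -> injective (recenter x t).
Proof. by move=> xi i j /addIr/xi. Qed.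

Lemma sum_knots n (x : 'I_n -> R) t (F : R -> R) :
  \sum_(b <- knots (recenter x t)) F b = \sum_(k < n) F (recenter x t k).
Proof. by rewrite /knots big_map. Qed.

Lemma sqr_sigma n t : (0 < n)%N -> sigma n t ^+ 2 = 1 + t ^+ 2 / n%:R.
Proof. by move=> n0; rewrite sqr_sqrtr// addr_ge0// divr_ge0// sqr_ge0. Qed.

Lemma sigma_ge1 n t : 1 <= sigma n t.
Proof.
by rewrite -[leLHS]sqrtr1 ler_wsqrtr// lerDl divr_ge0// sqr_ge0.
Qed.

Section Fixed.
Context {M n : nat} {x : 'I_n -> R}.
Hypotheses (M0 : (0 < M)%N) (Sx : standardized M x).

Let n0 : (0 < n)%N. Proof. by case: Sx; lia. Qed.
Let nR0 : 0 < n%:R :> R. Proof. by rewrite ltr0n. Qed.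

Lemma sum_recenter t : \sum_(k < n) recenter x t k = - t.
Proof.
have [_ h _ _ _] := Sx.
rewrite sumrB h sumr_const card_ord sub0r -[_ *+ n]mulr_natr divfK//.
exact: lt0r_neq0.
Qed.

Lemma sum_sqr_recenter t : \sum_(k < n) recenter x t k ^+ 2 = 1 + t ^+ 2 / n%:R.
Proof.
have [_ h1 h2 _ _] := Sx.
transitivity (\sum_(k < n) (x k ^+ 2 + (t ^+ 2 / n%:R ^+ 2 - (2 * t / n%:R) * x k))).
  by apply: eq_bigr => k _; rewrite /recenter; field; exact: lt0r_neq0.
rewrite big_split/= h2 sumrB -[X in _ - X]mulr_sumr h1 mulr0 subr0.
rewrite sumr_const card_ord -[_ *+ n]mulr_natr.
by congr (_ + _); field; exact: lt0r_neq0.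
Qed.

(** By [(y - z)^2 <= 2 y^2 + 2 z^2], the square of a recentred knot times [M] is at most
    [2 M x_k^2 + 2 M (t/n)^2 <= 1 + t^2/n]. *)
Lemma spread_recenter t : spread M (sigma n t) (knots (recenter x t)).
Proof.
have [_ h1 h2 h3 h4] := Sx; split.
- by apply: lt_le_trans (sigma_ge1 n t).
- move=> _ /mapP[k _ ->]; rewrite sqr_sigma// /recenter.
  have Mn : 2 * M%:R <= n%:R :> R by rewrite -natrM ler_nat.
  have h : 2 * M%:R * (t / n%:R) ^+ 2 <= t ^+ 2 / n%:R.
    have -> : 2 * M%:R * (t / n%:R) ^+ 2 = (2 * M%:R / n%:R) * (t ^+ 2 / n%:R).
      by field; exact: lt0r_neq0.
    rewrite ler_piMl ?divr_ge0 ?sqr_ge0//.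
    by rewrite ler_pdivrMr// mul1r.
  apply: le_trans (lerD (h3 k) h); rewrite -mulrDr -mulrA [leRHS]mulrCA.
  rewrite ler_wpM2l//; have := sqr_ge0 (x k + t / n%:R); lra.
- by rewrite sum_knots sum_sqr_recenter sqr_sigma.
Qed.

Lemma standardized_lt1 k : `|x k| < 1.
Proof.
have [_ _ _ h _] := Sx.
rewrite -(@ltr_pXn2r _ 2)// ?nnegrE// real_normK ?num_real// expr1n.
have M1 : 1 <= M%:R :> R by rewrite ler1n.
by have := h k; have := sqr_ge0 (x k); nra.
Qed.

Lemma recenter_le0 t k : n%:R <= t -> recenter x t k <= 0.
Proof.
move=> nt; have := standardized_lt1 k; rewrite ltr_norml => /andP[_ xk].
have : 1 <= t / n%:R by rewrite ler_pdivlMr// mul1r.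
by rewrite /recenter; lra.
Qed.

Lemma recenter_ge0 t k : n%:R <= - t -> 0 <= recenter x t k.
Proof.
move=> nt; have := standardized_lt1 k; rewrite ltr_norml => /andP[xk _].
have : 1 <= - t / n%:R by rewrite ler_pdivlMr// mul1r.
by rewrite mulNr /recenter; lra.
Qed.

Lemma divdiff_recenter_gt m t : n%:R <= t -> (0 < m)%N -> divdiff m (recenter x t) = 0.
Proof.
move=> nt m0; rewrite /divdiff big1// => k _.
by rewrite /pospow max_r ?recenter_le0// expr0n (gtn_eqF m0) mul0r.
Qed.

(** Far to the left all recentred knots are nonnegative, the truncated powers are plain powers, and
    [sum_lagrange] evaluates the sum. The exceptional exponent [n-1] will give the mass of the
    spline. *)
Lemma divdiff_recenter_lt m t : n%:R <= - t -> (m < n)%N ->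
  divdiff m (recenter x t) = (m == n.-1)%:R.
Proof.
have [xi _ _ _ _] := Sx.
move=> nt mn; rewrite -(sum_lagrange (recenter_inj (t := t) xi) mn).
by apply: eq_bigr => k _; rewrite /pospow max_l ?recenter_ge0.
Qed.

(** Compact support of the spline and its derivatives: it allows the kernel estimates to be
    restricted to [|t| <= n]. *)
Lemma divdiff_recenter_eq0 m t : n%:R <= `|t| -> (0 < m < n.-1)%N ->
  divdiff m (recenter x t) = 0.
Proof.
move=> nt /andP[m0 mn]; have [t0|t0] := leP 0 t.
  by rewrite divdiff_recenter_gt//; move: nt; rewrite ger0_norm.
rewrite divdiff_recenter_lt; last 2 first.
- by move: nt; rewrite ltr0_norm.
- by rewrite (leq_trans mn)// leq_pred.
by rewrite ltn_eqF.
Qed.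

(* Sum the tangent-type inequality [3/2 b y^2 - b^3/2 <= y^3] with [b = 1/n]. *)
Lemma inv_n_le_abs3 : n%:R^-1 <= abs3 x.
Proof.
have [_ _ h _ _] := Sx.
have E (y : R) : 0 <= y -> 3 / 2 / n%:R * y ^+ 2 - n%:R^-1 ^+ 3 / 2 <= y ^+ 3.
  move=> y0; set b := n%:R^-1; have b0 : 0 <= b by rewrite invr_ge0.
  rewrite -subr_ge0.
  have -> : y ^+ 3 - (3 / 2 / n%:R * y ^+ 2 - b ^+ 3 / 2) = (y - b) ^+ 2 * (y + b / 2).
    by rewrite -/b; field.
  by rewrite mulr_ge0 ?sqr_ge0//; lra.
have -> : abs3 x = \sum_(k < n) `|x k| ^+ 3 by [].
apply: (@le_trans _ _
  (\sum_(k < n) (3 / 2 / n%:R * `|x k| ^+ 2 - n%:R^-1 ^+ 3 / 2))); last first.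
  by apply: ler_sum => k _; exact: E.
rewrite sumrB -mulr_sumr sumr_const card_ord.
under eq_bigr do rewrite real_normK ?num_real//.
rewrite h mulr1 -(mulr_natr (n%:R^-1 ^+ 3 / 2)).
have -> : n%:R^-1 ^+ 3 / 2 * n%:R = n%:R^-1 ^+ 2 / 2 :> R by field; exact: lt0r_neq0.
have : 0 <= n%:R^-1 :> R by rewrite invr_ge0.
have : n%:R^-1 <= 1 :> R by rewrite invf_le1// ler1n.
by rewrite -mulrA; nra.
Qed.

(** From [(y + z)^3 <= 4 (y^3 + z^3)]: the shift contributes [|t|^3 / n^2] in total, which
    [inv_n_le_abs3] bounds by [|t|^3 * abs3 x]. *)
Lemma sum_abs3_recenter t :
  \sum_(k < n) `|recenter x t k| ^+ 3 <= 4 * (1 + `|t|) ^+ 3 * abs3 x.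
Proof.
have h y z : 0 <= y -> 0 <= z -> (y + z) ^+ 3 <= 4 * (y ^+ 3 + z ^+ 3) :> R.
  move=> y0 z0; rewrite -subr_ge0.
  have -> : 4 * (y ^+ 3 + z ^+ 3) - (y + z) ^+ 3 = 3 * (y + z) * (y - z) ^+ 2 by ring.
  by rewrite mulr_ge0 ?sqr_ge0//; lra.
apply: (@le_trans _ _ (\sum_(k < n) (4 * (`|x k| ^+ 3 + (`|t| / n%:R) ^+ 3)))).
  apply: ler_sum => k _; have tn0 : 0 <= `|t| / n%:R by rewrite divr_ge0.
  apply: le_trans (h _ _ (normr_ge0 _) tn0).
  rewrite lerXn2r ?nnegrE ?addr_ge0 ?divr_ge0//.
  by apply: (le_trans (ler_normB _ _)); rewrite normrM normfV normr_nat.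
rewrite -mulr_sumr -mulrA ler_wpM2l// big_split/= sumr_const card_ord -/(abs3 x).
rewrite -(mulr_natr ((`|t| / n%:R) ^+ 3)).
have -> : (`|t| / n%:R) ^+ 3 * n%:R = `|t| ^+ 3 * n%:R^-1 * n%:R^-1.
  by field; exact: lt0r_neq0.
have L0 : 0 <= abs3 x by rewrite sumr_ge0// => k _; rewrite exprn_ge0.
have n1 : n%:R^-1 <= 1 :> R by rewrite invf_le1// ler1n.
have n2 : 0 <= n%:R^-1 :> R by rewrite invr_ge0.
have t3 : 0 <= `|t| ^+ 3 by rewrite exprn_ge0.
apply: (@le_trans _ _ (abs3 x + `|t| ^+ 3 * abs3 x)).
  rewrite lerD2l -mulrA ler_wpM2l//; apply: le_trans inv_n_le_abs3.
  by rewrite ler_piMr.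
rewrite -[X in X + _]mul1r -mulrDl ler_wpM2r//.
have -> : (1 + `|t|) ^+ 3 = 1 + `|t| ^+ 3 + 3 * `|t| * (1 + `|t|) by ring.
by rewrite lerDl mulr_ge0// ?mulr_ge0// addr_ge0.
Qed.

End Fixed.

Lemma weight_le_pow (y : R) p : 0 <= y -> (2 + y) ^+ p <= 3 ^+ p * (1 + y ^+ p).
Proof.
move=> y0; have [y1|y1] := leP y 1.
  apply: (@le_trans _ _ (3 ^+ p)).
    by rewrite lerXn2r ?nnegrE//; lra.
  by rewrite ler_peMr ?exprn_ge0// lerDl exprn_ge0.
apply: (@le_trans _ _ (3 ^+ p * y ^+ p)).
  by rewrite -exprMn lerXn2r ?nnegrE//; lra.
by rewrite ler_wpM2l ?exprn_ge0// lerDr.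
Qed.

(** [kint_decay] controls powers of [|t| / sigma], and [sigma] grows with [t]. For [|t| <= n] one
    has [sigma^2 <= 1 + |t|], hence [|t| <= 1 + t^2 / sigma^2]: decay of order [2 p] in the ratio
    yields order [p] in [t]. *)
Lemma kint_weighted p q m : exists2 C : R, 0 <= C & forall M n (x : 'I_n -> R) t l,
  (p.*2 + q.+2 <= M)%N -> standardized M x -> `|t| <= n%:R ->
  (size l <= m)%N -> (forall a, a \in l -> M%:R * a ^+ 2 <= sigma n t ^+ 2) ->
  (1 + `|t|) ^+ p * `|kint q (l ++ knots (recenter x t))| <= C.
Proof.
have [C1 C10 H1] := @kint_decay R 0 q m.
have [C2 C20 H2] := @kint_decay R p.*2 q m.
exists (3 ^+ p * (C1 + C2)); first by rewrite mulr_ge0 ?exprn_ge0 ?addr_ge0.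
move=> M n x t l pM Sx tn lm la.
have M0 : (0 < M)%N by lia.
have qM : ((0 + q).+2 <= M)%N by lia.
have pqM : ((p.*2 + q).+2 <= M)%N by lia.
have n0 : (0 < n)%N by case: Sx; lia.
have nR0 : 0 < n%:R :> R by rewrite ltr0n.
set s := knots _; set K := `|kint _ _|; set sg := sigma n t.
have K0 : 0 <= K by exact: normr_ge0.
have sg1 : 1 <= sg by exact: sigma_ge1.
have sg0 : 0 < sg by lra.
have Hs : spread M sg (l ++ s).
  elim: l la {lm K K0} => [_|a l IHl la]; first exact: spread_recenter.
  apply: spread_cons; first by apply: la; rewrite mem_head.
  by apply: IHl => b bl; apply: la; rewrite inE bl orbT.
have s2 : \sum_(b <- s) b ^+ 2 <= sg ^+ 2.
  by rewrite sum_knots (sum_sqr_recenter M0 Sx) sqr_sigma.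
have := H1 l s sg (spreadW qM Hs) lm s2.
rewrite -/K expr0 mul1r mulr1 => B1.
have := H2 l s sg (spreadW pqM Hs) lm s2.
rewrite -/K (sum_knots _ _ id) (sum_recenter M0 Sx) normrN => B2.
have sgq : 1 <= sg ^+ q.+1 by rewrite exprn_ege1.
have {}B1 : K <= C1 by exact: (le_trans (ler_peMl K0 sgq) B1).
have {}B2 : (t ^+ 2 / sg ^+ 2) ^+ p * K <= C2.
  rewrite expr_div_n -!exprM mulrAC ler_pdivrMr ?exprn_gt0//.
  rewrite mul2n; apply: le_trans B2.
  rewrite -[t ^+ _]ger0_norm ?exprn_even_ge0 ?odd_double// normrX.
  by rewrite ler_wpM2l ?exprn_ge0// ler_peMl.
have tau : `|t| <= 1 + t ^+ 2 / sg ^+ 2.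
  rewrite sqr_sigma// -lerBlDl.
  have t2 : t ^+ 2 = `|t| ^+ 2 by rewrite real_normK ?num_real.
  have d0 : 0 < 1 + t ^+ 2 / n%:R by rewrite ltr_pwDl// divr_ge0// sqr_ge0.
  rewrite ler_pdivlMr// t2.
  have : `|t| ^+ 2 / n%:R <= `|t| by rewrite ler_pdivrMr// expr2 ler_wpM2l.
  have : 0 <= `|t| ^+ 2 / n%:R by rewrite divr_ge0// sqr_ge0.
  have := normr_ge0 t; set u := `|t|; set v := _ / _ => u0 v0 vu.
  have [u1|u1] := leP u 1; last by nra.
  apply: (@le_trans _ _ 0); last exact: sqr_ge0.
  by rewrite mulr_le0_ge0//; lra.
have y0 : 0 <= t ^+ 2 / sg ^+ 2 by rewrite divr_ge0 ?sqr_ge0.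
apply: (@le_trans _ _ (3 ^+ p * (1 + (t ^+ 2 / sg ^+ 2) ^+ p) * K)).
  rewrite ler_wpM2r//; apply: le_trans (weight_le_pow p y0).
  by rewrite lerXn2r ?nnegrE ?addr_ge0//; lra.
by rewrite -mulrA ler_wpM2l ?exprn_ge0// mulrDl mul1r lerD.
Qed.

End Standardized.

(** * Approximate Gaussian equations for the spline and its derivatives *)

Section SplineDerivatives.
Context {R : realType}.
Implicit Types (M p q m n : nat) (t : R).

(** Up to sign, the factor produced by [q] differentiations in [t]: each brings down the current
    exponent and the slope [-1/n]. *)
Definition falling_ratio n q : R := \prod_(i < q) ((n - 2 - i)%:R / n%:R).

Definition spline_der q n (x : 'I_n -> R) t : R :=
  (-1) ^+ q * falling_ratio n q * divdiff (n - 2 - q) (recenter x t).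

Lemma divdiff_recenterE m n (x : 'I_n -> R) t : divdiff m (recenter x t) =
  \sum_(k < n) pospow (x k - t / n%:R) m / \prod_(j < n | j != k) (x k - x j).
Proof.
apply: eq_bigr => k _; congr (_ / _); apply: eq_bigr => j _.
by rewrite /recenter; ring.
Qed.

Lemma spline_sumE n (x : 'I_n -> R) : spline_sum x = spline_der 0 x.
Proof.
apply/funext => t.
by rewrite /spline_der /falling_ratio big_ord0 expr0 !mul1r subn0 divdiff_recenterE.
Qed.

Lemma is_derive_divdiff m n (x : 'I_n -> R) t :
  is_derive t 1 (fun u => divdiff m.+2 (recenter x u))
    (- (m.+2%:R / n%:R) * divdiff m.+1 (recenter x t)).
Proof.
rewrite divdiff_recenterE mulr_sumr.
under [X in is_derive _ _ X _]eq_fun do rewrite divdiff_recenterE.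
pose d k := \prod_(j < n | j != k) (x k - x j).
apply: (@is_derive_sum_seq _ _ _ (fun k u => pospow (x k - u / n%:R) m.+2 / d k)
  (fun k u => - (m.+2%:R / n%:R) * (pospow (x k - u / n%:R) m.+1 / d k))) => k.
have dpos := is_derive_pospow (x k - t / n%:R) m.
have din : is_derive t 1 (fun u : R => x k - u / n%:R) (- n%:R^-1).
  apply: is_derive_eq; rewrite /GRing.scale/=; ring.
have dcomp := @is_derive1_comp _ (fun z => pospow z m.+2)
  (fun u : R => x k - u / n%:R) t _ _ dpos din.
have -> : (fun u => pospow (x k - u / n%:R) m.+2 / d k) =
   (fun u => (d k)^-1 *
     (((fun z => pospow z m.+2) \o (fun u : R => x k - u / n%:R)) u)).
  by apply/funext => u /=; rewrite mulrC.
apply: is_derive_eq; rewrite /GRing.scale/=.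
by ring.
Qed.

Lemma falling_ratioS n q :
  falling_ratio n q.+1 = falling_ratio n q * ((n - 2 - q)%:R / n%:R).
Proof. by rewrite /falling_ratio big_ord_recr. Qed.

Lemma falling_ratio_ge0 n q : 0 <= falling_ratio n q.
Proof. by apply: prodr_ge0 => i _; rewrite divr_ge0. Qed.

Lemma falling_ratio_le1 n q : (0 < n)%N -> falling_ratio n q <= 1.
Proof.
move=> n0; apply: prodr_ile1 => i _; rewrite divr_ge0//=.
by rewrite ler_pdivrMr ?ltr0n// mul1r ler_nat; lia.
Qed.

Lemma is_derive_spline_der q n (x : 'I_n -> R) t : (q + 4 <= n)%N ->
  is_derive t 1 (spline_der q x) (spline_der q.+1 x t).
Proof.
move=> qn; rewrite /spline_der.
have mE : (n - 2 - q = (n - 2 - q.+1).-1.+2)%N by lia.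
have mE' : (n - 2 - q.+1 = (n - 2 - q.+1).-1.+1)%N by lia.
have dd := is_derive_divdiff (n - 2 - q.+1).-1 x t.
rewrite -mE -mE' in dd.
apply: is_derive_eq; rewrite /GRing.scale/= falling_ratioS exprS.
by ring.
Qed.

Lemma divdiff_weighted p q : exists2 C : R, 0 <= C & forall M n (x : 'I_n -> R) t,
  (p.*2 + q.+3 <= M)%N -> standardized M x ->
  (1 + `|t|) ^+ p * `|divdiff (n - 2 - q) (recenter x t)| <= C.
Proof.
have [C C0 H] := @kint_weighted R p q 0.
exists C => // M n x t pM Sx.
have M0 : (0 < M)%N by lia.
have nM : (2 * M <= n)%N by case: Sx.
have [tn|tn] := leP `|t| n%:R; last first.
  by rewrite (divdiff_recenter_eq0 M0 Sx (ltW tn)) ?normr0 ?mulr0//; lia.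
have := H M n x t [::] ltac:(lia) Sx tn isT => /(_ ltac:(by [])).
apply: le_trans; rewrite ler_wpM2l ?exprn_ge0 ?addr_ge0//=.
have [xi _ _ _ _] := Sx.
rewrite (@kint_divdiff _ _ _ (recenter_inj xi) _ (sigma n t)); last 2 first.
- by lia.
- by apply: spreadW (spread_recenter M0 Sx t); lia.
rewrite normrM ler_peMl//.
by rewrite ger0_norm ?mulr_ge0 ?pi_ge0//; have := @pi_ge2 R; lra.
Qed.

(** The error made when the repeated knot is dropped from the quadratic terms of [kint_rec]. *)
Definition remainder q n (x : 'I_n -> R) t : R :=
  \sum_(k < n) recenter x t k ^+ 3 * kint q.+2 (recenter x t k :: knots (recenter x t)).

(** [kint_weighted] is used with weight [p + 3], to absorb the factor [(1 + |t|)^3] of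
    [sum_abs3_recenter], and with [q + 2]; this gives the threshold [2 (p + 3) + q + 4]. *)
Lemma remainder_weighted p q : exists2 C : R, 0 <= C & forall M n (x : 'I_n -> R) t,
  (p.*2 + q + 10 <= M)%N -> standardized M x -> `|t| <= n%:R ->
  (1 + `|t|) ^+ p * `|remainder q x t| <= C * abs3 x.
Proof.
have [C C0 H] := @kint_weighted R (p + 3) q.+2 1.
exists (4 * C) => [|M n x t pM Sx tn]; first by rewrite mulr_ge0.
have M0 : (0 < M)%N by lia.
have [_ ha _] := spread_recenter M0 Sx t.
set W := 1 + `|t|; have W0 : 0 < W by rewrite ltr_pwDl.
have W3 := exprn_gt0 3 W0; have Wp := exprn_ge0 p (ltW W0).
rewrite -[X in X * _]ger0_norm// -normrM mulr_sumr.
apply: (le_trans (ler_norm_sum _ _ _)).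
apply: (@le_trans _ _ (\sum_(k < n) `|recenter x t k| ^+ 3 * (C / W ^+ 3))).
  apply: ler_sum => k _; rewrite normrM ger0_norm// normrM normrX mulrCA.
  rewrite ler_wpM2l ?exprn_ge0// ler_pdivlMr// mulrAC -exprD.
  apply: (H M n x t [:: recenter x t k]) => //; first by lia.
  move=> a; rewrite inE => /eqP ->; apply: ha.
  by apply/mapP; exists k => //; rewrite mem_index_enum.
rewrite -mulr_suml.
apply: (@le_trans _ _ (4 * W ^+ 3 * abs3 x * (C / W ^+ 3))).
  by rewrite ler_wpM2r ?divr_ge0 ?(ltW W3)//; exact: (sum_abs3_recenter M0 Sx).
rewrite le_eqVlt; apply/orP; left; apply/eqP; field.
exact: lt0r_neq0.
Qed.

(** In [kint_rec] the knots sum to [-t]. A second use of [kint_shift] frees the integrals from the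
    repeated knot, so that the squares add up to [1 + t^2/n]. *)
Lemma kint_recenter_rec M q n (x : 'I_n -> R) t : (q + 4 <= M)%N -> standardized M x ->
  t * kint q (knots (recenter x t)) = q%:R * kint q.-1 (knots (recenter x t)) +
    (1 + t ^+ 2 / n%:R) * kint q.+1 (knots (recenter x t)) + remainder q x t.
Proof.
move=> qM Sx; have M0 : (0 < M)%N by lia.
have Hs := spread_recenter M0 Sx t; have [_ ha _] := Hs.
set s := knots (recenter x t).
have := @kint_rec _ q s _ (spreadW _ Hs) => /(_ ltac:(lia)).
rewrite (sum_knots _ _ id) (sum_recenter M0 Sx) opprK => ->.
rewrite -addrA; congr (_ + _).
rewrite (sum_knots _ _ (fun a => a ^+ 2 * kint q.+1 (a :: s))).
rewrite -(sum_sqr_recenter M0 Sx) mulr_suml -big_split/=; apply: eq_bigr => k _.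
have ks : recenter x t k \in s by apply/mapP; exists k => //; rewrite mem_index_enum.
rewrite (@kint_shift _ q.+1 _ _ (sigma n t)); first by ring.
- by apply: (@spreadW _ M); [lia|apply: spread_cons => //; exact: ha].
- by apply: spreadW Hs; lia.
Qed.

(** The Gaussian makes this expression vanish: it is [f' + t f = 0] differentiated [q] times. For
    the spline the defect comes from the excess [t^2/n] of the variance, from ratios of consecutive
    [falling_ratio], and from [remainder]. The first two are of order [1/n], which is at most
    [abs3 x]. *)
Lemma spline_der_stein p q : exists2 C : R, 0 <= C & forall M n (x : 'I_n -> R) t,
  (p.*2 + q + 20 <= M)%N -> standardized M x ->
  (1 + `|t|) ^+ p *
  `|spline_der q.+1 x t + t * spline_der q x t + q%:R * spline_der q.-1 x t|
  <= C * abs3 x.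
Proof.
(* Two extra powers of [1 + |t|] absorb the factor [t^2 + q + 2] of the first error term. *)
have [C1 C10 H1] := divdiff_weighted p.+2 q.+1.
have [C2 C20 H2] := divdiff_weighted p q.-1.
have [C3 C30 H3] := remainder_weighted p q.
exists (q.+2%:R * C1 + q%:R * q.+1%:R * C2 + C3).
  by rewrite !addr_ge0// !mulr_ge0.
move=> M n x t pM Sx.
have M0 : (0 < M)%N by lia.
have nM : (2 * M <= n)%N by case: Sx.
have n0 : (0 < n)%N by lia.
have qM : (q + 4 <= M)%N by lia.
have qM1 : (p.+2.*2 + q.+1.+3 <= M)%N by lia.
have qM2 : (p.*2 + q.-1.+3 <= M)%N by lia.
have qM3 : (p.*2 + q + 10 <= M)%N by lia.
have qM4 : (q.+3 <= M)%N by lia.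
have qn : (q.+3 < n)%N by lia.
have qn2 : (q.+2 <= n)%N by lia.
have qn1 : (q.+1 <= n)%N by lia.
have nE2 : (n - 2 - q = n - q.+2)%N by lia.
have nE1 : (0 < q)%N -> (n - 2 - q.-1 = n - q.+1)%N by lia.
have q1q : (q.-1 <= q.+1)%N by lia.
have mlt j : (j <= q.+1)%N -> (0 < n - 2 - j < n.-1)%N by lia.
have nR0 : 0 < n%:R :> R by rewrite ltr0n.
have L1 := inv_n_le_abs3 M0 Sx.
have L0 : 0 <= abs3 x by apply: le_trans L1; rewrite invr_ge0.
have [tn|tn] := leP `|t| n%:R; last first.
  have G0 j : (j <= q.+1)%N -> spline_der j x t = 0.
    by move=> jq; rewrite /spline_der (divdiff_recenter_eq0 M0 Sx (ltW tn)) ?mulr0 ?mlt.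
  rewrite (G0 q.+1)// (G0 q)// (G0 q.-1)// !mulr0 !addr0 normr0 mulr0.
  by rewrite mulr_ge0// !addr_ge0// !mulr_ge0.
have {}H1 := H1 M n x t qM1 Sx.
have {}H2 := H2 M n x t qM2 Sx.
have {}H3 := H3 M n x t qM3 Sx tn.
have [xi _ _ _ _] := Sx.
have Hs := spread_recenter M0 Sx t.
have D j : (j <= q.+1)%N -> kint j (knots (recenter x t)) =
    2 * pi * divdiff (n - 2 - j) (recenter x t).
  move=> jq; apply: (@kint_divdiff _ _ _ (recenter_inj xi) _ (sigma n t)).
    by apply: leq_ltn_trans qn; rewrite !ltnS.
  by apply: spreadW Hs; apply: leq_trans qM4; rewrite !ltnS.
have pi0 : 2 * pi != 0 :> R by rewrite lt0r_neq0// mulr_gt0 ?pi_gt0.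
have := kint_recenter_rec t qM Sx.
rewrite (D q)// (D q.-1)// (D q.+1)//.
set G0 := divdiff (n - 2 - q) _; set Gm := divdiff (n - 2 - q.-1) _.
set Gp := divdiff (n - 2 - q.+1) _ => rec.
have {}rec : t * G0 = q%:R * Gm + (1 + t ^+ 2 / n%:R) * Gp + remainder q x t / (2 * pi).
  move: pi0 rec; move: (2 * pi) => P P0 rec.
  by apply: (mulfI P0); rewrite mulrCA rec; field; rewrite P0 (lt0r_neq0 nR0).
pose k := falling_ratio n q; pose km := falling_ratio n q.-1.
have k0 : 0 <= k <= 1 by rewrite falling_ratio_ge0 falling_ratio_le1.
have km0 : 0 <= km <= 1 by rewrite falling_ratio_ge0 falling_ratio_le1.
have kS : falling_ratio n q.+1 = k * (1 - q.+2%:R / n%:R).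
  rewrite falling_ratioS -/k nE2 natrB//.
  by rewrite mulrBl divff// lt0r_neq0.
have kP : q%:R * (k - km) = - (q%:R * km * (q.+1%:R / n%:R)).
  rewrite /k /km; have [->|q0] := eqVneq q 0%N; first by rewrite !mul0r oppr0.
  have qE : q = q.-1.+1 by rewrite prednK// lt0n.
  rewrite [in falling_ratio n q]qE falling_ratioS.
  rewrite nE1 ?lt0n// natrB//; move: (falling_ratio _ _) => r.
  by field; exact: lt0r_neq0.
have sgm : q%:R * spline_der q.-1 x t = - (-1) ^+ q * (q%:R * km * Gm).
  rewrite /spline_der -/km -/Gm; have [->|q0] := eqVneq q 0%N.
    by rewrite !mul0r mulr0.
  have qE : q = q.-1.+1 by rewrite prednK// lt0n.
  have sE : (-1) ^+ q = - (-1) ^+ q.-1 :> R by rewrite {1}qE exprS mulN1r.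
  by rewrite sE; ring.
(* The main parts cancel: [kS] and [kP] leave multiples of [1/n] in front of [Gp] and [Gm]. *)
have -> : spline_der q.+1 x t + t * spline_der q x t + q%:R * spline_der q.-1 x t =
   (-1) ^+ q * (k * ((t ^+ 2 + q.+2%:R) / n%:R) * Gp + q%:R * (k - km) * Gm +
     k * (remainder q x t / (2 * pi))).
  rewrite sgm /spline_der kS -/k -/Gp -/G0 exprS.
  have -> : t * ((-1) ^+ q * k * G0) = (-1) ^+ q * k * (t * G0) by ring.
  by rewrite rec; ring.
rewrite kP normrM normrX normrN1 expr1n mul1r.
set W := 1 + `|t| in H1 H2 H3 *; have W1 : 1 <= W by rewrite lerDl.
have W0 : 0 < W by lra.
have Wp := exprn_ge0 p (ltW W0).
have := ler_normD
  (k * ((t ^+ 2 + q.+2%:R) / n%:R) * Gp + - (q%:R * km * (q.+1%:R / n%:R)) * Gm)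
  (k * (remainder q x t / (2 * pi))).
have := ler_normD (k * ((t ^+ 2 + q.+2%:R) / n%:R) * Gp)
  (- (q%:R * km * (q.+1%:R / n%:R)) * Gm).
move=> N1 N2.
have {N1 N2} N := le_trans N2 (lerD N1 (lexx _)).
apply: (le_trans (ler_wpM2l Wp N)).
have [k00 k1] := andP k0; have [km00 km1] := andP km0.
have i0 : 0 <= n%:R^-1 :> R by rewrite invr_ge0.
rewrite [leLHS]mulrDr [X in X + _ <= _]mulrDr [leRHS]mulrDl [X in _ <= X + _]mulrDl.
apply: lerD; first apply: lerD.
- rewrite normrM ger0_norm; last first.
    by rewrite mulr_ge0// divr_ge0// addr_ge0// sqr_ge0.
  apply: (@le_trans _ _ (W ^+ p * ((q.+2%:R * W ^+ 2 * abs3 x) * `|Gp|))).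
    rewrite ler_wpM2l// ler_wpM2r//.
    apply: (@le_trans _ _ (1 * (q.+2%:R * W ^+ 2 * abs3 x))); last by rewrite mul1r.
    apply: ler_pM => //; first by rewrite divr_ge0// addr_ge0// sqr_ge0.
    apply: ler_pM => //; first by rewrite addr_ge0// sqr_ge0.
    rewrite -real_normK ?num_real// /W.
    have -> : q.+2%:R = 1 + q.+1%:R :> R by rewrite nat1r.
    have : 0 <= q.+1%:R :> R by [].
    have := normr_ge0 t; set u := `|t|; set v := q.+1%:R => u0 v0.
    have -> : (1 + v) * (1 + u) ^+ 2 =
        u ^+ 2 + (1 + v) + (2 * u + v * (2 * u + u ^+ 2)) by ring.
    by rewrite lerDl addr_ge0 ?mulr_ge0 ?addr_ge0 ?mulr_ge0 ?sqr_ge0.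
  have -> : W ^+ p * (q.+2%:R * W ^+ 2 * abs3 x * `|Gp|) =
     q.+2%:R * abs3 x * (W ^+ p.+2 * `|Gp|) by rewrite -[p.+2]addn2 exprD; ring.
  by rewrite [leRHS]mulrAC ler_wpM2l// mulr_ge0.
- rewrite mulNr normrN normrM ger0_norm; last first.
    by rewrite mulr_ge0// ?mulr_ge0// divr_ge0.
  apply: (@le_trans _ _ (W ^+ p * ((q%:R * q.+1%:R * abs3 x) * `|Gm|))).
    rewrite ler_wpM2l// ler_wpM2r// -!mulrA ler_wpM2l//.
    rewrite -[leRHS]mul1r; by apply: ler_pM => //; rewrite ?divr_ge0// ler_wpM2l.
  rewrite mulrCA [leRHS]mulrAC ler_wpM2l// !mulr_ge0//.
- apply: le_trans H3; rewrite ler_wpM2l// normrM ger0_norm//.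
  rewrite -[leRHS]mul1r; apply: ler_pM => //.
  rewrite normrM ler_piMr// normfV invf_le1; last by rewrite normr_gt0.
  by rewrite ger0_norm ?mulr_ge0 ?pi_ge0//; have := @pi_ge2 R; lra.
Qed.

End SplineDerivatives.

(** * Stability of the Gaussian differential equation *)

Section GaussianOde.
Context {R : realType}.
Implicit Types (e de : R -> R) (K t : R) (p : nat).

Lemma is_derive_continuous (f df : R -> R) :
  (forall x : R, is_derive x 1 f (df x)) -> continuous f.
Proof.
move=> fd x; apply: differentiable_continuous; apply/derivable1_diffP.
exact: (@ex_derive _ _ _ _ _ _ _ (fd x)).
Qed.

(** With the integrating factor [exp(u^2/2)], the difference between the comparison function and [e]
    has a nonnegative derivative and vanishes at 0. *)
Let ode_half e de K t : 0 <= K -> (forall u : R, is_derive u 1 e (de u)) -> e 0 = 0 ->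
  (forall u, de u + u * e u <= K) -> 0 <= t -> e t <= 2 * K * t / (1 + t ^+ 2).
Proof.
move=> K0 ed e0 eK t0.
have pos (u : R) : 0 < 1 + u ^+ 2 by have := sqr_ge0 u; lra.
have pn (u : R) : 1 + u ^+ 2 != 0 by exact: lt0r_neq0.
pose f u := (2 * K * (u / (1 + u ^+ 2)) - e u) * expR (u ^+ 2 / 2).
pose df u := (2 * K * ((1 + u ^+ 4) / (1 + u ^+ 2) ^+ 2) - (de u + u * e u))
  * expR (u ^+ 2 / 2).
have fd (u : R) : is_derive u 1 f (df u).
  apply: is_derive_eq; rewrite /GRing.scale/= /df.
  by move: (expR _) => X; field.
have df0 u : 0 <= df u.
  rewrite /df mulr_ge0 ?expR_ge0// subr_ge0; apply: (le_trans (eK u)).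
  (* For [w = 2 K u / (1 + u^2)] one finds [w' + u w = 2 K (1 + u^4) / (1 + u^2)^2], at least [K]
     because [(u^2 - 1)^2 >= 0]. *)
  have h : 1 <= 2 * ((1 + u ^+ 4) / (1 + u ^+ 2) ^+ 2).
    rewrite mulrA ler_pdivlMr ?exprn_gt0// mul1r.
    have -> : u ^+ 4 = (u ^+ 2) ^+ 2 by rewrite -exprM.
    by have := sqr_ge0 (u ^+ 2 - 1); lra.
  by rewrite [2 * K]mulrC -mulrA ler_peMr.
have [c _] : exists2 c, c \in `[0, t]%R & f t - f 0 = df c * (t - 0).
  apply: MVT_segment => //; apply: continuous_subspaceT.
  exact: is_derive_continuous fd.
have -> : f 0 = 0 by rewrite /f e0 mul0r mulr0 subr0 mul0r.
rewrite !subr0 => ft.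
have : 0 <= f t by rewrite ft mulr_ge0.
by rewrite /f pmulr_lge0 ?expR_gt0// subr_ge0 mulrA.
Qed.

Let ode_abs e de K t : 0 <= K -> (forall u : R, is_derive u 1 e (de u)) -> e 0 = 0 ->
  (forall u, `|de u + u * e u| <= K) -> 0 <= t -> `|e t| <= 2 * K * t / (1 + t ^+ 2).
Proof.
move=> K0 ed e0 eK t0; rewrite ler_norml; apply/andP; split.
  rewrite lerNl.
  apply: (@ode_half (fun u => - e u) (fun u => - de u)) => //.
  - by rewrite e0 oppr0.
  - move=> u; rewrite mulrN -opprD lerNl.
    by have := eK u; rewrite ler_norml => /andP[].
apply: (@ode_half e de) => // u.
by have := eK u; rewrite ler_norml => /andP[].
Qed.

(* On each half-line [e] is compared with [w t = 2 K t / (1 + t^2)], which satisfies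
   [w' + t w >= K]. *)
Lemma gauss_ode e de K t : (forall u : R, is_derive u 1 e (de u)) -> e 0 = 0 ->
  (forall u, `|de u + u * e u| <= K) -> `|e t| <= K.
Proof.
move=> ed e0 eK.
have K0 : 0 <= K by apply: le_trans (eK 0).
have pos : 0 < 1 + t ^+ 2 by have := sqr_ge0 t; lra.
apply: (@le_trans _ _ (2 * K * `|t| / (1 + t ^+ 2))); last first.
  rewrite ler_pdivrMr// mulrAC mulrC ler_wpM2l//.
  have := sqr_ge0 (`|t| - 1); rewrite sqrrB real_normK ?num_real//; lra.
have [t0|t0] := leP 0 t; first by rewrite (ger0_norm t0); exact: ode_abs.
rewrite (ltr0_norm t0) -[t ^+ 2]sqrrN -{1}[t]opprK.
apply: (@ode_abs (fun u => e (- u)) (fun u => - de (- u))) => //; last first.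
- by rewrite oppr_ge0 ltW.
- move=> u; have -> : - de (- u) + u * e (- u) = - (de (- u) + - u * e (- u)) by ring.
  by rewrite normrN.
- by rewrite oppr0.
- move=> u; have d := ed (- u).
  have dN : is_derive u 1 (fun v : R => - v) (-1).
    by apply: is_derive_eq.
  have := @is_derive1_comp _ e (fun v : R => - v) u _ _ d dN.
  by rewrite mulrN1.
Qed.

(** The function [u^(p+1) e] satisfies the same equation with right-hand side
    [u^(p+1) (e' + u e) + (p+1) u^p e], whose last term the induction hypothesis controls. *)
Lemma gauss_ode_pow p : exists2 B : R, 0 <= B & forall e de K,
  (forall u : R, is_derive u 1 e (de u)) -> e 0 = 0 ->
  (forall j u, (j <= p)%N -> `|u| ^+ j * `|de u + u * e u| <= K) ->
  forall t, `|t| ^+ p * `|e t| <= B * K.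
Proof.
elim: p => [|p [B B0 IHp]].
  exists 1 => // e de K ed e0 eK t; rewrite expr0 !mul1r.
  apply: (@gauss_ode e de K t ed e0) => u.
  by have := eK 0%N u isT; rewrite expr0 mul1r.
exists (1 + p.+1%:R * B); first by rewrite addr_ge0// mulr_ge0.
move=> e de K ed e0 eK t.
have IH := IHp e de K ed e0 (fun j u (jp : (j <= p)%N) => eK j u (leqW jp)).
rewrite -normrX -normrM.
apply: (@gauss_ode (fun u => u ^+ p.+1 * e u)
  (fun u => p.+1%:R * u ^+ p * e u + u ^+ p.+1 * de u)).
- move=> u; have edu := ed u.
  have dX := @is_deriveX R _ id p.+1 u 1 1 (is_derive_id u 1).
  have -> : (fun v => v ^+ p.+1 * e v) = (id ^+ p.+1) * e.
    by apply/funext => v; rewrite /= exprfctE.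
  apply: is_derive_eq; rewrite /GRing.scale/= exprfctE.
  by ring.
- by rewrite e0 mulr0.
- move=> u.
  have -> : p.+1%:R * u ^+ p * e u + u ^+ p.+1 * de u + u * (u ^+ p.+1 * e u) =
    u ^+ p.+1 * (de u + u * e u) + p.+1%:R * (u ^+ p * e u) by ring.
  apply: (le_trans (ler_normD _ _)); rewrite mulrDl mul1r; apply: lerD.
    by rewrite normrM normrX; exact: eK.
  rewrite normrM normr_nat -mulrA ler_wpM2l// normrM normrX; exact: IH.
Qed.

Lemma gauss_ode_weighted p : exists2 B : R, 0 <= B & forall e de K,
  (forall u : R, is_derive u 1 e (de u)) -> e 0 = 0 ->
  (forall u, (1 + `|u|) ^+ p * `|de u + u * e u| <= K) ->
  forall t, (1 + `|t|) ^+ p * `|e t| <= B * K.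
Proof.
have [B1 B10 H1] := gauss_ode_pow 0.
have [B2 B20 H2] := gauss_ode_pow p.
exists (3 ^+ p * (B1 + B2)); first by rewrite mulr_ge0 ?exprn_ge0 ?addr_ge0.
move=> e de K ed e0 eK t.
have eK' j u : (j <= p)%N -> `|u| ^+ j * `|de u + u * e u| <= K.
  move=> jp; apply: le_trans (eK u); rewrite ler_wpM2r//.
  apply: (@le_trans _ _ ((1 + `|u|) ^+ j)).
    by rewrite lerXn2r ?nnegrE// ?addr_ge0// lerDr.
  by rewrite ler_weXn2l// lerDl.
have b1 := H1 e de K ed e0
  (fun j u (j0 : (j <= 0)%N) => eK' j u (leq_trans j0 (leq0n p))) t.
have b2 := H2 e de K ed e0 eK' t.
rewrite expr0 mul1r in b1.
apply: (@le_trans _ _ (3 ^+ p * (1 + `|t| ^+ p) * `|e t|)).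
  rewrite ler_wpM2r//; apply: le_trans (weight_le_pow p (normr_ge0 t)).
  by rewrite lerXn2r ?nnegrE ?addr_ge0// lerD2r; lra.
by rewrite -!mulrA ler_wpM2l ?exprn_ge0// mulrDl mul1r mulrDl lerD.
Qed.

Lemma weight_expR_bound p : exists2 D : R, 0 <= D & forall t,
  (1 + `|t|) ^+ p * expR (- t ^+ 2 / 2) <= D.
Proof.
(* Chosen so that the bound [1 + |t| <= c exp(t^2/c)], raised to the power [p + 1], produces exactly
   [exp(t^2/2)]. *)
pose c : R := 2 * p.+1%:R.
have c2 : 2 <= c by rewrite ler_peMr// ler1n.
have c0 : 0 < c by lra.
exists (c ^+ p.+1) => [|t]; first by rewrite exprn_ge0// ltW.
have W1 : 1 <= 1 + `|t| by rewrite lerDl.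
have h : 1 + `|t| <= c * expR (t ^+ 2 / c).
  apply: (@le_trans _ _ (c * (1 + t ^+ 2 / c))); last first.
    by rewrite ler_pM2l// expR_ge1Dx.
  rewrite mulrDr mulr1 mulrCA divff ?mulr1 ?lt0r_neq0//.
  by rewrite -real_normK ?num_real//; have := sqr_ge0 (`|t| - 1); rewrite sqrrB; lra.
rewrite mulNr expRN ler_pdivrMr ?expR_gt0//.
have -> : expR (t ^+ 2 / 2) = expR (t ^+ 2 / c) ^+ p.+1.
  rewrite -expRM_natl /c; congr expR; field.
  by rewrite lt0r_neq0.
rewrite -exprMn; apply: (@le_trans _ _ ((1 + `|t|) ^+ p.+1)).
  by rewrite ler_weXn2l.
rewrite lerXn2r ?nnegrE//; first by lra.
Qed.

End GaussianOde.

(** * Comparison of the spline with the Gaussian density *)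

Section GaussianApproximation.
Context {R : realType}.
Implicit Types (M p q n : nat) (t : R).
Notation mu := (@lebesgue_measure R).

(** These are [(-1)^q He_q] times the density, given by the Hermite recurrence, which is the form
    matched by [spline_der_stein]. *)
Fixpoint gauss_der q t : R :=
  if q is q1.+1 then
    if q1 is q2.+1 then - t * gauss_der q1 t - q1%:R * gauss_der q2 t
    else - t * gauss_density t
  else gauss_density t.

Lemma gauss_derS q t :
  gauss_der q.+1 t = - t * gauss_der q t - q%:R * gauss_der q.-1 t.
Proof. by case: q => [|q] //=; rewrite mul0r subr0. Qed.

(** The recurrence has two terms, so the induction carries two consecutive derivatives. *)
Lemma is_derive_gauss_der q t : is_derive t 1 (gauss_der q) (gauss_der q.+1 t).
Proof.
suff H : is_derive t 1 (gauss_der q) (gauss_der q.+1 t) /\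
    is_derive t 1 (gauss_der q.+1) (gauss_der q.+2 t) by case: H.
have d0 : is_derive t 1 (@gauss_density R) (- t * gauss_density t).
  rewrite /gauss_density; apply: is_derive_eq; rewrite /GRing.scale/=.
  by move: (expR _) (_ / _) => X c; field.
elim: q => [|q [IH1 IH2]].
  split => //=; apply: is_derive_eq; rewrite /GRing.scale/=.
  by ring.
split => //.
have G2 u : gauss_der q.+2 u = - u * gauss_der q.+1 u - q.+1%:R * gauss_der q u.
  exact: gauss_derS.
have G3 : gauss_der q.+3 t = - t * gauss_der q.+2 t - q.+2%:R * gauss_der q.+1 t.
  exact: gauss_derS.
move: IH1 IH2 G2 G3.
move: (gauss_der q) (gauss_der q.+1) (gauss_der q.+2) (gauss_der q.+3).
move=> f0 f1 f2 f3 d01 d12 f2E ->.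
have -> : f2 = (fun u => - u * f1 u - q.+1%:R * f0 u) by exact/funext.
apply: is_derive_eq; rewrite /GRing.scale/= f2E -[q.+2%:R]natr1.
by ring.
Qed.

Let sqrt2pi := Num.sqrt (2 * pi) : R.

Let sqrt2pi_ge1 : 1 <= sqrt2pi.
Proof. by rewrite -[leLHS]sqrtr1 ler_wsqrtr//; have := @pi_ge2 R; lra. Qed.

Let expR_gauss t : expR (- t ^+ 2 / 2) = sqrt2pi * gauss_density t.
Proof.
rewrite /gauss_density mulrA div1r divff ?mul1r//.
by apply: lt0r_neq0; apply: lt_le_trans sqrt2pi_ge1.
Qed.

Let gauss_normal : @gauss_density R = normal_pdf 0 1.
Proof.
apply/funext => t; rewrite normal_pdfE ?oner_neq0// /normal_fun /gauss_density.
by rewrite /normal_peak /normal_fun subr0 !expr1n !mul1r mulr_natl.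
Qed.

Lemma integrable_gauss : integrableR (@gauss_density R).
Proof. by rewrite gauss_normal; exact: integrable_normal_pdf. Qed.

Lemma integral_gauss : integralR (@gauss_density R) = 1.
Proof. by rewrite gauss_normal /integralR /Rintegral integral_normal_pdf. Qed.

Lemma weight2_bound (y K t : R) : (1 + `|t|) ^+ 2 * `|y| <= K ->
  `|y| <= K / (1 + (1 * t) ^+ 2).
Proof.
move=> h; rewrite mul1r ler_pdivlMr; last by have := sqr_ge0 t; lra.
apply: le_trans h; rewrite mulrC ler_wpM2r// sqrrD real_normK ?num_real//.
by have := normr_ge0 t; lra.
Qed.

(** The antiderivative is a multiple of the divided difference with exponent [n-1], which is 1 to
    the left of [-n] and 0 to the right of [n]. *)
Lemma integral_spline M n (x : 'I_n -> R) : (7 <= M)%N -> standardized M x ->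
  integrableR (spline_der 0 x) /\ integralR (spline_der 0 x) = n%:R / n.-1%:R.
Proof.
move=> M7 Sx; have M0 : (0 < M)%N by lia.
have nM : (2 * M <= n)%N by case: Sx.
have n4 : (0 + 4 <= n)%N by lia.
have n1 : (0 < n.-1)%N by lia.
have n0 : (0 < n)%N by lia.
have mE : n.-1 = (n - 3).+2 by lia.
have mE' : (n - 2 = (n - 3).+1)%N by lia.
have cs : continuous (spline_der 0 x).
  by apply: is_derive_continuous => u; exact: is_derive_spline_der.
have [C C0 H] := @divdiff_weighted R 2 0.
have int_s : integrableR (spline_der 0 x).
  apply: (integrableRP (K := C) (c := 1)) => // u; apply: weight2_bound.
  rewrite /spline_der /falling_ratio big_ord0 expr0 !mul1r.
  by apply: (H M).
split => //.
pose F t := - (n%:R / n.-1%:R) * divdiff n.-1 (recenter x t).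
have nn0 : n%:R != 0 :> R by rewrite pnatr_eq0 -lt0n.
have nn1 : n.-1%:R != 0 :> R by rewrite pnatr_eq0 -lt0n.
apply: (@integralR_FTC _ F (spline_der 0 x) _ int_s cs).
  move=> t; have := is_derive_divdiff (n - 3) x t; rewrite -mE -mE' => d.
  rewrite /F; apply: is_derive_eq.
  rewrite /spline_der /falling_ratio big_ord0 expr0 !mul1r subn0 /GRing.scale/=.
  by move: (divdiff _ _) => d1; field; rewrite nn0 nn1.
apply: cvg_near_cst; near=> k.
have nk : n%:R <= k%:R :> R by near: k; exact: nbhs_infty_ger.
rewrite /F (divdiff_recenter_gt M0 Sx)// (divdiff_recenter_lt M0 Sx) ?opprK//;
  last by rewrite ltn_predL.
by rewrite eqxx mulr0 sub0r mulr1 opprK.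
Unshelve. all: by end_near. Qed.

Definition error_der q n (x : 'I_n -> R) t := gauss_der q t - spline_der q x t.

Lemma is_derive_error q n (x : 'I_n -> R) t : (q + 4 <= n)%N ->
  is_derive t 1 (error_der q x) (error_der q.+1 x t).
Proof.
move=> qn; have d1 := is_derive_gauss_der q t; have d2 := is_derive_spline_der x t qn.
exact: is_deriveB.
Qed.

Lemma error_derS q n (x : 'I_n -> R) t :
  error_der q.+1 x t = - t * error_der q x t - q%:R * error_der q.-1 x t -
    (spline_der q.+1 x t + t * spline_der q x t + q%:R * spline_der q.-1 x t).
Proof. by rewrite /error_der gauss_derS; ring. Qed.

(* The homogeneous solution is removed from the error; its coefficient [error_der 0 x 0]
   is then read off the total masses [1] and [n / (n - 1)]. *)
Lemma error0_weighted p : exists2 C : R, 0 <= C & forall M n (x : 'I_n -> R) t,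
  (p.*2 + 30 <= M)%N -> standardized M x ->
  (1 + `|t|) ^+ p * `|error_der 0 x t| <= C * abs3 x.
Proof.
have [A1 A10 HA1] := @spline_der_stein R 2 0.
have [A2 A20 HA2] := @spline_der_stein R p 0.
have [B1 B10 HB1] := @gauss_ode_weighted R 2.
have [B2 B20 HB2] := @gauss_ode_weighted R p.
have [D D0 HD] := @weight_expR_bound R p.
(* Bounds [h0]: the 2 comes from the difference of the masses, the other term from the integral of
   [e], which decays like [(1 + |u|)^-2]. *)
pose C1 := 2 + B1 * A1 * (pi / 1).
have C10 : 0 <= C1 by rewrite addr_ge0 // mulr_ge0 // ?divr_ge0 ?pi_ge0 // mulr_ge0.
exists (B2 * A2 + C1 * D); first by rewrite addr_ge0 ?mulr_ge0.
move=> M n x t pM Sx.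
have M0 : (0 < M)%N by lia.
have M7 : (7 <= M)%N by lia.
have nM : (2 * M <= n)%N by case: Sx.
have n4 : (0 + 4 <= n)%N by lia.
have n2 : (2 <= n)%N by lia.
have pM1 : (2.*2 + 0 + 20 <= M)%N by lia.
have pM2 : (p.*2 + 0 + 20 <= M)%N by lia.
have L1 := inv_n_le_abs3 M0 Sx.
have L0 : 0 <= abs3 x by apply: le_trans L1; rewrite invr_ge0.
pose h0 := error_der 0 x 0.
pose e u := error_der 0 x u - h0 * expR (- u ^+ 2 / 2).
pose de u := error_der 1 x u + h0 * (u * expR (- u ^+ 2 / 2)).
have ed (u : R) : is_derive u 1 e (de u).
  have d := is_derive_error x u n4.
  rewrite /e /de; apply: is_derive_eq; rewrite /GRing.scale/=.
  by move: (expR _) => X; field.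
have e0 : e 0 = 0 by rewrite /e expr0n/= oppr0 mul0r expR0 mulr1 subrr.
have eE u : de u + u * e u =
    - (spline_der 1 x u + u * spline_der 0 x u + 0%:R * spline_der 0 x u).
  by rewrite /de /e error_derS; ring.
have e1 := HB1 e de (A1 * abs3 x) ed e0 (fun u => _).
have {}e1 u : (1 + `|u|) ^+ 2 * `|e u| <= B1 * (A1 * abs3 x).
  by apply: e1 => v; rewrite eE normrN; exact: (HA1 M n x v pM1 Sx).
have e2 u : (1 + `|u|) ^+ p * `|e u| <= B2 * (A2 * abs3 x).
  by apply: (HB2 e de _ ed e0) => v; rewrite eE normrN; exact: (HA2 M n x v pM2 Sx).
have [iS mS] := integral_spline M7 Sx.
have h0L : `|h0| <= C1 * abs3 x.
  have ce : continuous e by exact: is_derive_continuous ed.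
  have b := le_integralR ltr01 ce (fun u => weight2_bound (e1 u)).
  have eI : integralR e = 1 - n%:R / n.-1%:R - h0 * sqrt2pi.
    transitivity (integralR (@gauss_density R) - integralR (spline_der 0 x) -
      h0 * sqrt2pi * integralR (@gauss_density R)); last first.
      by rewrite integral_gauss mS mulr1.
    rewrite /integralR -RintegralB//; last exact: integrable_gauss.
    rewrite -RintegralZl//; last exact: integrable_gauss.
    rewrite -RintegralB//.
    - apply: eq_Rintegral => u _; rewrite /e expR_gauss [error_der 0 x u]/error_der /=.
      by move: sqrt2pi (gauss_density u) (spline_der 0 x u) => s g f; ring.
    - exact: (integrableB _ integrable_gauss iS).
    - exact: (integrableZl _ _ integrable_gauss).
  have n1 : 0 < n.-1%:R :> R by rewrite ltr0n; case: (n) n2 => [|[]].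
  have nE : n%:R = n.-1%:R + 1 :> R by rewrite natr1 prednK// ltnW.
  have nr1 : 1 <= n.-1%:R :> R by rewrite ler1n; case: (n) n2 => [|[]].
  (* The masses differ by [1/(n-1) <= 2/n], and [1/n <= abs3 x]. *)
  have r2 : `|1 - n%:R / n.-1%:R| <= 2 * abs3 x :> R.
    apply: (@le_trans _ _ (2 * n%:R^-1)); last by rewrite ler_wpM2l.
    have -> : 1 - n%:R / n.-1%:R = - n.-1%:R^-1 :> R.
      by rewrite nE mulrDl divff ?lt0r_neq0// mul1r; lra.
    rewrite normrN ger0_norm ?invr_ge0 ?(ltW n1)// ler_pdivlMr; last by rewrite nE; lra.
    by rewrite mulrC ler_pdivrMr// nE; lra.
  apply: (@le_trans _ _ (`|h0| * sqrt2pi)); first by rewrite ler_peMr.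
  have -> : `|h0| * sqrt2pi = `|(1 - n%:R / n.-1%:R) - integralR e|.
    rewrite eI opprB addrC subrK normrM; congr (_ * _).
    by rewrite ger0_norm ?sqrtr_ge0.
  apply: (le_trans (ler_normB _ _)).
  apply: (le_trans (lerD r2 b)).
  by rewrite /C1 le_eqVlt; apply/orP; left; apply/eqP; move: (pi / 1) => P; ring.
have -> : error_der 0 x t = e t + h0 * expR (- t ^+ 2 / 2) by rewrite /e subrK.
apply: (@le_trans _ _ ((1 + `|t|) ^+ p * (`|e t| + `|h0| * expR (- t ^+ 2 / 2)))).
  rewrite ler_wpM2l ?exprn_ge0 ?addr_ge0//.
  by apply: (le_trans (ler_normD _ _)); rewrite normrM (ger0_norm (expR_ge0 _)).
rewrite mulrDr mulrDl; apply: lerD; first by rewrite -mulrA.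
rewrite mulrCA [leRHS]mulrAC; exact: ler_pM.
Qed.

(** Strong induction on [q] through [error_derS]. The factor [t] there costs one more weight on the
    lower derivative, so [p] varies and the threshold involves [p + q]. *)
Lemma error_weighted p q : exists2 C : R, 0 <= C & forall M n (x : 'I_n -> R) t,
  ((p + q).*2 + q + 30 <= M)%N -> standardized M x ->
  (1 + `|t|) ^+ p * `|error_der q x t| <= C * abs3 x.
Proof.
elim/ltn_ind: q p => -[|q] IHq p.
  have [C C0 H] := error0_weighted p; exists C => // M n x t pM.
  by apply: H; lia.
have [C1 C10 H1] := IHq q (ltnSn q) p.+1.
have [C2 C20 H2] := IHq q.-1 (leq_pred q) p.
have [C3 C30 H3] := @spline_der_stein R p q.
exists (C1 + q%:R * C2 + C3); first by rewrite !addr_ge0 ?mulr_ge0.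
move=> M n x t pM Sx.
have pM1 : ((p.+1 + q).*2 + q + 30 <= M)%N by lia.
have pM2 : ((p + q.-1).*2 + q.-1 + 30 <= M)%N by lia.
have pM3 : (p.*2 + q + 20 <= M)%N by lia.
have {}H1 := H1 M n x t pM1 Sx.
have {}H2 := H2 M n x t pM2 Sx.
have {}H3 := H3 M n x t pM3 Sx.
set W := 1 + `|t| in H1 H2 H3 *.
have Wp : 0 <= W ^+ p by rewrite exprn_ge0 ?addr_ge0.
rewrite error_derS; set S := spline_der _ _ _ + _ + _ in H3 *.
apply: (@le_trans _ _ (W ^+ p * (`|t| * `|error_der q x t| +
   q%:R * `|error_der q.-1 x t| + `|S|))).
  rewrite ler_wpM2l//; apply: (le_trans (ler_normB _ _)); rewrite lerD2r.
  apply: (le_trans (ler_normB _ _)).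
  by rewrite 2!normrM normrN normr_nat.
rewrite [leLHS]mulrDr [X in X + _ <= _]mulrDr [leRHS]mulrDl [X in _ <= X + _]mulrDl.
apply: lerD => //; apply: lerD.
  apply: le_trans H1; rewrite exprSr -mulrA ler_wpM2l// ler_wpM2r//.
  by rewrite /W lerDr.
by rewrite mulrCA -mulrA ler_wpM2l.
Qed.

Lemma derive1n_error q n (x : 'I_n -> R) : (q + 4 <= n)%N ->
  derive1n q (error_der 0 x) = error_der q x.
Proof.
elim: q => [|q IHq] qn; first by rewrite derive1n0.
have qn' : (q + 4 <= n)%N by lia.
rewrite derive1nS IHq//; apply/funext => t.
rewrite derive1E; have d := is_derive_error x t qn'.
exact: (@derive_val _ _ _ _ _ _ _ d).
Qed.

(** A single term of the cubic sum is at most the whole, so [|x_k| <= 1/(2 M) <= 1], and therefore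
    [2 M x_k^2 <= 1]. *)
Lemma standardized_of_abs3 M n (x : 'I_n -> R) : (0 < M)%N -> (2 * M <= n)%N ->
  (forall i j : 'I_n, (i < j)%N -> x i < x j) ->
  \sum_(k < n) x k = 0 -> \sum_(k < n) x k ^+ 2 = 1 ->
  abs3 x <= (2 * M%:R)^-1 ^+ 3 -> standardized M x.
Proof.
move=> M0 Mn xmono s1 s2 s3; split => //.
- move=> i j xij; apply/val_inj/eqP.
  by case: ltngtP => // /xmono; rewrite xij ltxx.
- move=> k.
  have M1 : 1 <= M%:R :> R by rewrite ler1n.
  have d0 : 0 < 2 * M%:R :> R by lra.
  have xk : `|x k| <= (2 * M%:R)^-1.
    rewrite -(@ler_pXn2r _ 3)// ?nnegrE ?invr_ge0 ?(ltW d0)//.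
    apply: le_trans s3; rewrite /abs3 (bigD1 k)//= lerDl.
    by rewrite sumr_ge0// => i _; rewrite exprn_ge0.
  rewrite -[x k ^+ 2]real_normK ?num_real// expr2 mulrA.
  have h1 : 2 * M%:R * `|x k| <= 1 by rewrite mulrC -ler_pdivlMr// div1r.
  have h2 : `|x k| <= 1 by apply: (le_trans xk); rewrite invf_le1//; lra.
  exact: mulr_ile1.
Qed.

End GaussianApproximation.

Theorem theorem1 (R : realType) (p q : nat) :
  exists (n0 : nat) (eps C : R),
    [/\ 0 < eps, 0 < C &
      forall (n : nat) (x : 'I_n -> R),
        (n0 <= n)%N ->
        (forall i j : 'I_n, (i < j)%N -> x i < x j) ->
        \sum_(k < n) x k = 0 ->
        \sum_(k < n) x k ^+ 2 = 1 ->
        \sum_(k < n) `|x k| ^+ 3 <= eps ->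
        forall t : R,
          derivable_up_to q (fun s : R => gauss_density s - spline_sum x s) t /\
          `| t ^+ p * derive1n q (fun s : R => gauss_density s - spline_sum x s) t |
            <= C * \sum_(k < n) `|x k| ^+ 3].
Proof.
have [C C0 H] := @error_weighted R p q.
pose M := ((p + q).*2 + q + 30)%N.
have M0 : (0 < M)%N by rewrite /M; lia.
(* The first two witnesses are what [standardized_of_abs3] requires for the threshold [M] of
   [error_weighted]; adding 1 makes the constant strictly positive. *)
exists (2 * M)%N, ((2 * M%:R)^-1 ^+ 3), (C + 1); split.
- by rewrite exprn_gt0// invr_gt0 mulr_gt0// ltr0n.
- by lra.
move=> n x nM xmono s1 s2 s3 t.
have Sx := standardized_of_abs3 M0 nM xmono s1 s2 s3.
have -> : (fun s : R => gauss_density s - spline_sum x s) = error_der 0 x.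
  by apply/funext => s; rewrite spline_sumE.
have qn i : (i <= q)%N -> (i + 4 <= n)%N by move: nM; rewrite /M; lia.
split => [i iq|].
  rewrite derive1n_error; last by apply: qn; exact: ltnW.
  have d := is_derive_error x t (qn i (ltnW iq)).
  exact: (@ex_derive _ _ _ _ _ _ _ d).
rewrite derive1n_error ?qn// normrM normrX.
apply: (@le_trans _ _ ((1 + `|t|) ^+ p * `|error_der q x t|)).
  by rewrite ler_wpM2r// lerXn2r ?nnegrE ?addr_ge0// lerDr.
apply: (le_trans (H M n x t (leqnn _) Sx)); rewrite ler_wpM2r ?lerDl//.
by rewrite sumr_ge0// => k _; rewrite exprn_ge0.
Qed.
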